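(* Let $p\geq 0$ and let $G$ be a balanced bipartite graph of order $2n$ with minimum degree $\delta(G)\geq k$, where $n\geq (k+2)(k-p+1)$. If $k\geq p+1$ and $q(G)\geq q(M_{n,n}^{n-k,k-p})$, then $G$ is $2p$-Hamilton-biconnected unless $G= M_{n,n}^{n-k,k-p}$.
   Context: $q(G)$ is the signless Laplacian spectral radius, i.e. the largest eigenvalue of $D(G)+A(G)$ where $D(G)$ is the diagonal degree matrix and $A(G)$ the adjacency matrix. A bipartite graph $G=(X,Y;E)$ is balanced if $|X|=|Y|$; it is Hamilton-biconnected if for every $u\in X$, $v\in Y$ there is a Hamiltonian path with ends $u,v$. A vertex set $W$ is balanced if $|W\cap X|=|W\cap Y|$; $G$ is $2p$-Hamilton-biconnected if for every balanced $W$ with $|W|=2p$, the subgraph induced by $V(G)\setminus W$ is Hamilton-biconnected. $M_{n,m}^{s,t}$: parts $X=X_1\cup X_2$, $Y=Y_1\cup Y_2$, $|X_1|=s$, $|X_2|=n-s$, $|Y_1|=m-t$, $|Y_2|=t$; edges are all pairs between $X_1$ and $Y_1$, between $X_2$ and $Y_1$, and between $X_2$ and $Y_2$. ''$G=H$'' means isomorphic. *)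

(* Defs.v *)
From HB Require Import structures.
From mathcomp Require Import all_boot all_order all_algebra.
From mathcomp Require Import fingroup perm.
From mathcomp Require Import classical_sets reals.
Set Implicit Arguments. Unset Strict Implicit. Unset Printing Implicit Defensive.
Import Order.TTheory GRing.Theory Num.Theory.

(* A balanced bipartite graph of order 2n with parts X, Y (|X|=|Y|=n) is
   given by its biadjacency relation b : rel 'I_n  (b x y <-> xy is an edge,
   x in X, y in Y).  Vertices are 'I_(n+n): i < n is the vertex
   [split i = inl x] of X, i >= n is the vertex [split i = inr y] of Y. *)

Definition inX (n : nat) (i : 'I_(n + n)) : bool :=
  if split i is inl _ then true else false.

Definition adj (n : nat) (b : rel 'I_n) : rel 'I_(n + n) :=
  fun i j =>
    match split i, split j with
    | inl x, inr y => b x y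
    | inr y, inl x => b x y
    | _, _ => false
    end.

Definition deg (n : nat) (b : rel 'I_n) (i : 'I_(n + n)) : nat :=
  #|[pred j | adj b i j]|.

Definition Qmat (R : realType) (n : nat) (b : rel 'I_n) : 'M[R]_(n + n) :=
  \matrix_(i, j) (((deg b i)%:R * (i == j)%:R + (adj b i j)%:R)%R).

Definition qrad (R : realType) (n : nat) (b : rel 'I_n) : R :=
  sup [set a : R | eigenvalue (Qmat R b) a].

Definition ham_path (T : finType) (e : rel T) (S : {set T}) (u v : T) : Prop :=
  exists s : seq T,
    [/\ uniq (u :: s), path e u s, last u s = v &
        forall x, (x \in u :: s) = (x \in S)].

Definition ham_biconnected (n : nat) (b : rel 'I_n) (S : {set 'I_(n + n)}) : Prop :=
  forall u v, u \in S -> v \in S -> inX u -> ~~ inX v -> ham_path (adj b) S u v.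

Definition ham_biconnected_2p (p n : nat) (b : rel 'I_n) : Prop :=
  forall W : {set 'I_(n + n)},
    #|W| = (2 * p)%N ->
    #|[set i in W | inX i]| = #|[set i in W | ~~ inX i]| ->
    ham_biconnected b (~: W).

(* M_{n,n}^{s,t}: X1 = {x < s}, X2 = {x >= s}, Y1 = {y < n - t}, Y2 = {y >= n - t};
   edges X1-Y1, X2-Y1, X2-Y2. *)
Definition Mb (n s t : nat) : rel 'I_n :=
  fun x y => (y < n - t) || (s <= x).

Definition graph_iso (n : nat) (b1 b2 : rel 'I_n) : Prop :=
  exists f : {perm 'I_(n + n)}, forall i j, adj b1 (f i) (f j) = adj b2 i j.

Arguments Mb : clear implicits.
Arguments qrad R {n} b.
Arguments Qmat R {n} b.

(* Main.v *)
Require Import Defs.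
From HB Require Import structures.
From mathcomp Require Import all_boot all_order all_algebra.
From mathcomp Require Import fingroup perm.
From mathcomp Require Import zify ring lra.
Set Implicit Arguments. Unset Strict Implicit. Unset Printing Implicit Defensive.

(** Put [t = k - p]. If [w] is an eigenvector of [Q = D + A] for [q], then
[z = |w|] satisfies [Q z >= q z] entrywise, and this is all that is used of the
spectrum of [G]. The spectral radius of the extremal graph [M] is at least the
larger root [l] of [(l - 2n + t)(l - k) = t k]. Pairing [Q z >= l z] with the
degree vector gives [n l <= n^2 + e(G)], hence [G] has fewer than [n t]
nonadjacent pairs.

Delete [W] and close the remaining graph, with [m = n - p] vertices on each side,
under the Bondy-Chvatal operation (join nonadjacent [x] and [y] of degree sum at
least [m + 2]). In a closed graph [t + 1] disjoint nonadjacent pairs would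
account for [n t] nonadjacent pairs, so at most [t] vertices cover all of
them. Then either the Hamiltonian path can be built explicitly, or [G] has [t]
vertices of degree at most [k] on one side, or [t = 2] and [G] has two adjacent
vertices of degree at most [k]. Summing the inequalities [Q z >= q z] shows that the
first exception forces [G = M] and that the second one cannot occur. *)

(** * Hamiltonian paths in bipartite graphs *)

(** The quadratic for [l] is the eigenvalue equation of [M] for vectors constant on its four cells.
    Its larger root exceeds [2n - t], which is what turns the bound on [n l] into fewer than [n t]
    nonadjacent pairs. In a closed graph [t + 1] disjoint nonadjacent pairs have at least
    [(t+1)(m-1)] nonneighbours in all, and at most [(t+1)^2] nonadjacent pairs are counted twice
    there. What is left reaches [n t] exactly when [(t+1)(k+2) <= n], which is the hypothesis on
    [n]. Both exceptions are real obstructions. If [t] vertices of one side have the same [t]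
    neighbours and none of them is an end, a Hamiltonian path would put [2t] edges on these [2t]
    vertices and so contain a cycle. If two adjacent vertices of degree two are both interior, they
    are consecutive on the path, and when [u] and [v] are their other neighbours the path consists
    of these four vertices only. Hence the exceptions have to be refuted spectrally. They are found
    in the closure but needed for [G], so they are recorded as upper bounds on degrees, which
    survive the removal of edges. *)

Section HamPath.
Variables (V : finType) (e : rel V).
Hypothesis e_sym : symmetric e.
Implicit Types (S : {set V}) (u v w : V) (s r : seq V).

Lemma ham_path_cons S u w v :
  u \in S -> e u w -> ham_path e (S :\ u) w v -> ham_path e S u v.
Proof.
move=> uS euw [s [us ps ls mem_s]]; exists (w :: s).
have uN : u \notin w :: s by rewrite mem_s !inE eqxx.
split=> //=; first by rewrite uN.
  by rewrite euw.
move=> x; rewrite in_cons mem_s in_setD1.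
by case: eqVneq => [->|].
Qed.

Lemma ham_path_sym S u v : ham_path e S u v -> ham_path e S v u.
Proof.
move=> [s [us ps ls mem_s]]; exists (rev (belast u s)).
have E : v :: rev (belast u s) = rev (u :: s) by rewrite [u :: s]lastI rev_rcons ls.
split; rewrite ?E ?rev_uniq //.
- by rewrite -ls rev_path (eq_path (e' := e)) // => a b; rewrite /= e_sym.
- by case: s {us ps mem_s E} ls => [|a s] //= _; rewrite rev_cons last_rcons.
- by move=> x; rewrite mem_rev mem_s.
Qed.

Lemma ham_path_rcons S u w v :
  v \in S -> e w v -> ham_path e (S :\ v) u w -> ham_path e S u v.
Proof.
move=> vS ewv /ham_path_sym H; apply: ham_path_sym.
by apply: ham_path_cons H; rewrite // e_sym.
Qed.

Lemma sorted_rcons_cat_cons r a b s :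
  sorted e (rcons r a ++ b :: s) =
  [&& sorted e (rcons r a), e a b & sorted e (b :: s)].
Proof.
by case: r => [|z r] //=; rewrite cat_path last_rcons /=.
Qed.

Lemma sorted_rev_sym s : sorted e (rev s) = sorted e s.
Proof. by rewrite rev_sorted (eq_sorted (e' := e)) // => a b; rewrite /= e_sym. Qed.

(* The rotation of Ore: the path is cut between [a] and [b] and between the
   consecutive vertices [y] and [z], and reconnected by [a y] and [b z]. *)
Lemma reconnect_path r a b s r1 y z r2 :
  ~~ e a a ->
  rcons r a ++ b :: s = r1 ++ y :: z :: r2 ->
  sorted e (rcons r a) -> sorted e (b :: s) -> e a y -> e b z ->
  exists w : seq V, [/\ perm_eq w (rcons r a ++ b :: s), sorted e w,
    forall d, head d w = head d (rcons r a ++ b :: s) &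
    forall d, last d w = last d (rcons r a ++ b :: s)].
Proof.
move=> eaa E sp sq eay ebz.
(* Either [y z] lies before the cut and the piece from [z] to [a] is reversed, or it lies after the
   cut and the piece from [b] to [y] is reversed, or [y = a], which [e a y] excludes. *)
have [lt | lt | eqs] := ltngtP (size r1).+1 (size (rcons r a)).
- have [r3 Ep] : exists r3, rcons r a = r1 ++ y :: z :: r3.
    exists (take (size (rcons r a) - (size r1).+2) r2).
    have := congr1 (take (size (rcons r a))) E.
    rewrite take_size_cat // => {1}->.
    rewrite -!cat_rcons take_cat !size_rcons ltnNge.
    by rewrite size_rcons in lt; rewrite lt.
  have Er2 : r2 = r3 ++ b :: s.
    move: E; rewrite Ep -catA /= => /eqP.
    by rewrite eqseq_cat // eqxx /= => /eqP [].
  have La : a = last z r3.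
    by have := congr1 (last a) Ep; rewrite last_rcons last_cat.
  have [r4 E4] : exists r4, rev (z :: r3) = rcons (a :: r4) z \/ (r3 = [::] /\ a = z).
    case: r3 {Ep Er2} La => [|d r3] La; first by exists [::]; right.
    exists (rev (belast d r3)); left.
    by rewrite rev_cons lastI rev_rcons /= La.
  (* When [z = a], the edge [b z] already bridges the cut and the list is kept. *)
  case: E4 => [E4 | [? ?]]; last first.
    subst r3 z; exists (rcons r a ++ b :: s); split=> //.
    by rewrite sorted_rcons_cat_cons sp e_sym ebz.
  exists (rcons r1 y ++ rev (z :: r3) ++ b :: s).
  have Ew : rcons r1 y ++ rev (z :: r3) ++ b :: s =
            rcons r1 y ++ a :: (rcons r4 z ++ b :: s) by rewrite E4.
  move: sp; rewrite Ep -cat_rcons sorted_rcons_cat_cons => /and3P[s1 _ s2].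
  split.
  + by rewrite -catA perm_cat2l perm_cat2r perm_rev.
  + rewrite Ew sorted_rcons_cat_cons s1 e_sym eay /=.
    have -> : path e a (rcons r4 z ++ b :: s) = sorted e (rcons (a :: r4) z ++ b :: s).
      by [].
    by rewrite sorted_rcons_cat_cons -E4 sorted_rev_sym s2 e_sym ebz.
  + by move=> d; case: (r1).
  + by move=> d; rewrite !last_cat.
- have szr : size (rcons r a) <= size r1 by [].
  have Eq : b :: s = drop (size (rcons r a)) r1 ++ y :: z :: r2.
    have := congr1 (drop (size (rcons r a))) E.
    rewrite drop_size_cat // drop_cat; move: szr.
    rewrite leq_eqVlt => /orP[/eqP -> | -> //].
    by rewrite ltnn subnn drop0 drop_size.
  move: (drop _ _) Eq => r0 Eq.
  have [r4 E4] : exists r4, rcons r0 y = b :: r4.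
    by case: r0 Eq => [[-> _]|d r0 [-> _]]; [exists [::] | exists (rcons r0 y)].
  exists (rcons r a ++ rev (rcons r0 y) ++ z :: r2).
  move: sq; rewrite Eq -cat_rcons sorted_rcons_cat_cons => /and3P[s1 _ s2].
  split.
  + by rewrite perm_cat2l perm_cat2r perm_rev.
  + rewrite rev_rcons /= sorted_rcons_cat_cons sp eay /=.
    have -> : path e y (rev r0 ++ z :: r2) = sorted e (rev (rcons r0 y) ++ z :: r2).
      by rewrite rev_rcons.
    rewrite E4 rev_cons sorted_rcons_cat_cons ebz s2 andbT.
    by rewrite -rev_cons -E4 sorted_rev_sym s1.
  + by move=> d; case: (r).
  + by move=> d; rewrite !last_cat.
- move: E; rewrite -[r1 ++ _]cat_rcons => /eqP.
  rewrite eqseq_cat; last by rewrite -eqs size_rcons.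
  rewrite eqseq_rcons => /andP[/andP[_ /eqP ay] _].
  by rewrite -ay (negPf eaa) in eay.
Qed.

End HamPath.

Lemma has_consecutive (T : eqType) (P : rel T) u s :
  has (fun p => P p.1 p.2) (zip (belast u s) s) ->
  exists r1 y z r2, u :: s = r1 ++ y :: z :: r2 /\ P y z.
Proof.
elim: s u => [|z s IHs] u //= /orP[Puz | /IHs [r1 [y [z' [r2 [-> Pyz]]]]]].
  by exists [::], u, z, s.
by exists (u :: r1), y, z', r2.
Qed.

(** * Closure under degree sums, and paths around a small exceptional set *)

Section Bipartite.
Variables (V : finType) (c : pred V).
Implicit Types (e : rel V) (S L : {set V}) (u v x y : V).

Definition bipartite e := symmetric e /\ forall x y, e x y -> c x != c y.

Definition side S b := [set x in S | c x == b].
Definition nbr e S x := [set y in S | e x y].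
Definition nonnbr e S x := [set y in S | (c y != c x) && ~~ e x y].

Definition add_edge e x y : rel V :=
  fun a b => e a b || ((a == x) && (b == y)) || ((a == y) && (b == x)).

Lemma bipartite_irr e x : bipartite e -> e x x = false.
Proof. by move=> [_ be]; apply/negP => /be; rewrite eqxx. Qed.

Lemma bipartite_add_edge e x y :
  bipartite e -> c x != c y -> bipartite (add_edge e x y).
Proof.
move=> [es be] cxy; split.
  move=> a b; rewrite /add_edge es -!orbA; congr orb.
  by rewrite orbC; congr orb; rewrite andbC.
move=> a b; rewrite /add_edge => /orP[/orP[/be //|]|] /andP[/eqP-> /eqP->] //.
by rewrite eq_sym.
Qed.

Lemma card_count (T : finType) (s : seq T) (P : pred T) (A : {set T}) :
  uniq s -> s =i A -> count P s = #|[set x in A | P x]|.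
Proof.
move=> us sA; rewrite -size_filter -(card_uniqP (filter_uniq P us)).
by apply: eq_card => x; rewrite mem_filter !inE sA andbC.
Qed.

(** A path repeats no vertex, so it crosses the new edge at most once: the part before the crossing
    avoids [b], the part after it avoids [a], and both therefore lie in [e]. *)
Lemma path_add_edge e x y u s :
  uniq (u :: s) -> x != y -> path (add_edge e x y) u s ->
  path e u s \/ exists r a b r',
    [/\ u :: s = rcons r a ++ b :: r', (a, b) = (x, y) \/ (a, b) = (y, x),
       sorted e (rcons r a) & sorted e (b :: r')].
Proof.
move=> us xy ps.
have [|nb] := boolP (has (fun p => (p == (x, y)) || (p == (y, x))) (zip (belast u s) s)).
  rewrite (eq_has (a2 := fun p => (((p.1, p.2) == (x, y)) || ((p.1, p.2) == (y, x)))));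
    last by case.
  case/(@has_consecutive _ (fun a b => ((a, b) == (x, y)) || ((a, b) == (y, x))))
    => r1 [a [b [r2 [E ab]]]].
  right; exists r1, a, b, r2.
  rewrite cat_rcons; split=> //; first by case/orP: ab => /eqP; [left | right].
    have : sorted (add_edge e x y) (rcons r1 a).
      have : sorted (add_edge e x y) (u :: s) by [].
      rewrite E -cat_rcons; case: (r1) => [|d r] //=.
      by rewrite cat_path => /andP[].
    have bN : b \notin rcons r1 a.
      move: us; rewrite E -cat_rcons cat_uniq /= => /and3P[_ + _].
      by rewrite negb_or => /andP[].
    apply: sub_in_sorted (allss _) => i j; rewrite /= => iP jP.
    have ib : i == b = false by apply: contraNF bN => /eqP <-.
    have jb : j == b = false by apply: contraNF bN => /eqP <-.
    by case/orP: ab => /eqP [] ? ?; subst; rewrite /add_edge ib jb ?andbF ?orbF.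
  have : sorted (add_edge e x y) (b :: r2).
    have : sorted (add_edge e x y) (u :: s) by [].
    rewrite E -cat_rcons; case: (r1) => [|d r] /=; first by case/andP.
    by rewrite cat_path /= last_rcons => /and3P[].
  have aN : a \notin b :: r2.
    move: us; rewrite E cat_uniq /= => /and3P[_ _ /andP[]] //.
  apply: sub_in_sorted (allss _) => i j; rewrite /= => iP jP.
  have ia : i == a = false by apply: contraNF aN => /eqP <-.
  have ja : j == a = false by apply: contraNF aN => /eqP <-.
  by case/orP: ab => /eqP [] ? ?; subst; rewrite /add_edge ia ja ?andbF ?orbF.
left; elim: s u {us} ps nb => [|z s IHs] u //= /andP[euz ps].
rewrite negb_or => /andP[+ /IHs -> //]; rewrite andbT.
rewrite !xpair_eqE; move: euz; rewrite /add_edge.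
by case: (e u z) => //=; move=> ->.
Qed.

(** Let the path cross the new edge from [a] to [b]. Consecutive vertices [y z] with [a] adjacent to
    [y] and [b] to [z] allow a reconnection; such a [y] has the colour opposite to [a], and the
    degree sum exceeds the number of candidates. The ends explain the threshold [m + 2]: [v] may be
    a neighbour of [a] without successor, and [u] a neighbour of [b] without predecessor. *)
Lemma bondy_chvatal e S x y u v m :
  bipartite e -> c x -> ~~ c y -> c u -> ~~ c v ->
  #|side S true| = m -> #|side S false| = m ->
  m + 2 <= #|nbr e S x| + #|nbr e S y| -> ~~ e x y ->
  ham_path (add_edge e x y) S u v -> ham_path e S u v.
Proof.
move=> be cx cy cu cv mX mY dxy nexy [s [us ps ls mem_s]].
have xy : x != y by apply: contraNneq cy => <-.
have [?|[r [a [b [r' [E ab sp sq]]]]]] := path_add_edge us xy ps; first by exists s.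
have [es ce] := be.
have cab : c a != c b by case: ab => [] [-> ->]; rewrite ?cx (negPf cy).
have dab : m + 2 <= #|nbr e S a| + #|nbr e S b|.
  by case: ab => [] [-> ->] //; rewrite [X in _ <= X]addnC.
have cnt (P : pred V) : count P (belast u s) + P v = #|[set z in S | P z]|.
  by rewrite -(card_count P us mem_s) lastI -cats1 count_cat /= addn0 ls.
have cnt' (P : pred V) : P u + count P s = #|[set z in S | P z]|.
  by rewrite -(card_count P us mem_s).
have ca := cnt (e a); have cb := cnt' (e b); have cc := cnt (fun z => c z != c a).
have cS : #|[set z in S | c z != c a]| = m.
  case Ca: (c a); [rewrite -mY | rewrite -mX]; apply: eq_card => z;
  by rewrite !inE; case: (c z).
rewrite cS in cc.
have szb : size (belast u s) = size s by rewrite size_belast.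
have ca' : count (e a) (belast u s) = count (fun p => e a p.1) (zip (belast u s) s).
  by rewrite -{1}(unzip1_zip (s := belast u s) (t := s)) ?szb // count_map.
have cb' : count (e b) s = count (fun p => e b p.2) (zip (belast u s) s).
  by rewrite -{1}(unzip2_zip (s := belast u s) (t := s)) ?szb // count_map.
have cc' : count (fun z => c z != c a) (belast u s) =
           count (fun p => c p.1 != c a) (zip (belast u s) s).
  by rewrite -{1}(unzip1_zip (s := belast u s) (t := s)) ?szb // count_map.
have sub : count (predU (fun p => e a p.1) (fun p => e b p.2)) (zip (belast u s) s)
   <= count (fun p => c p.1 != c a) (zip (belast u s) s).
  have alt : all (fun p => c p.1 != c p.2) (zip (belast u s) s).
    have cxy : c x != c y by rewrite cx (negPf cy).
    have [_ ce'] := bipartite_add_edge be cxy.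
    elim: (s) u ps {us ls mem_s E cu cnt cnt' ca cb cc szb ca' cb' cc'} => //= z s' IH u'.
    by move=> /andP[/ce' -> /IH ->].
  apply: leq_trans (_ : count _ (filter (fun p => c p.1 != c p.2) (zip (belast u s) s)) <= _).
    by rewrite (all_filterP alt).
  rewrite count_filter; apply: sub_count => -[i j] /=.
  case/andP=> /orP[/ce|/ce]; first by rewrite eq_sym.
  by move: cab; case: (c a); case: (c b); case: (c i); case: (c j).
have := count_predUI (fun p => e a p.1) (fun p => e b p.2) (zip (belast u s) s).
(* Without such a pair the two counts add up to at most the number of candidates. This is [m - 1] if
   [c a], when [v] has no successor and each degree may lose one, and [m] otherwise, when neither
   degree loses anything. *)
have [hI|nI] := boolP (has (fun p => e a p.1 && e b p.2) (zip (belast u s) s)); last first.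
  have -> : count (predI (fun p => e a p.1) (fun p => e b p.2)) (zip (belast u s) s) = 0.
    by apply/eqP; rewrite -leqn0 leqNgt -has_count.
  have cv' : (c v != c a) = c a by rewrite (negPf cv); case: (c a).
  have eav : e a v -> c a by move=> /ce; rewrite (negPf cv); case: (c a).
  have ebu : e b u -> c a by move=> /ce; rewrite cu; move: cab; case: (c a); case: (c b).
  move: sub dab ca cb cc; rewrite cv' ca' cb' cc' -/(nbr e S a) -/(nbr e S b).
  move: eav ebu.
  move: (count _ _) (count _ _) (count _ _) (count _ _) #|nbr e S a| #|nbr e S b|.
  clear; move=> nU nc na nb da db.
  case: (e a v); case: (e b u); case: (c a) => /=; clear; lia.
move=> _; have [r1 [y' [z [r2 [E2 /andP[eay ebz]]]]]] 
  := @has_consecutive _ (fun i j => e a i && e b j) _ _ hI.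
have [w [pw sw hw lw]] :=
  reconnect_path es (negbT (bipartite_irr a be)) (etrans (esym E) E2) sp sq eay ebz.
case: w pw sw hw lw => [/perm_size|u' w pw sw hw lw]; first by rewrite -E.
have ? : u' = u by have := hw u; rewrite -E.
subst u'; exists w; split.
- by rewrite (perm_uniq pw) -E.
- by [].
- by have := lw u; rewrite -E /= ls.
- by move=> i; rewrite (perm_mem pw) -E mem_s.
Qed.

Lemma card_side S : #|S| = #|side S true| + #|side S false|.
Proof.
rewrite -(cardsID [set x | c x] S); congr (_ + _); apply: eq_card => x;
by rewrite !inE; case: (c x); rewrite ?andbT ?andbF.
Qed.

Lemma card_sideD1 S a b : a \in S -> #|side S b| = (c a == b) + #|side (S :\ a) b|.
Proof.
move=> aS; rewrite (cardsD1 a) !inE aS; congr (_ + _).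
by apply: eq_card => x; rewrite !inE andbA.
Qed.

Lemma card_nbrD1 e S a x : a \in S -> #|nbr e S x| = e x a + #|nbr e (S :\ a) x|.
Proof.
move=> aS; rewrite (cardsD1 a) !inE aS; congr (_ + _).
by apply: eq_card => y; rewrite !inE andbA.
Qed.

Lemma card_gt1_neq (T : finType) (A : {set T}) a :
  1 < #|A| -> exists2 x, x \in A & x != a.
Proof.
move=> A1; have /card_gt0P [x] : 0 < #|A :\ a|.
  by rewrite (cardsD1 a A) in A1; have := leq_b1 (a \in A); lia.
by rewrite !inE => /andP[xa xA]; exists x.
Qed.

Definition full_outside e S L :=
  forall x y, x \in S -> c x -> x \notin L -> y \in S -> ~~ c y -> e x y.

(** Degrees at least [#|L|] on [L] do not suffice, since all of [L] might see the same [#|L|]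
    vertices. Either one vertex of [L] has a neighbour to spare, or the path starts inside [L],
    which saves one neighbour provided that [v] is not among those needed by the rest of [L]. *)
Definition startable e S L u v :=
  [\/ #|L| = 0,
      exists2 s, s \in L & #|L| < #|nbr e S s| |
      [/\ u \in L, (forall s, s \in L -> s != u -> ~~ e s v) &
          exists2 y, y \in nbr e S u & y != v]].

(* Each step removes one vertex [s] of [L] together with a path segment
   through [s] at one of the two ends. It deletes at most one neighbour of
   the other vertices of [L], so the degree condition survives. *)
Lemma ham_path_full_outside e m S L u v :
  bipartite e -> #|side S true| = m -> #|side S false| = m ->
  L \subset side S true -> u \in S -> c u -> v \in S -> ~~ c v ->
  full_outside e S L -> (forall x, x \in L -> #|L| <= #|nbr e S x|) ->
  2 * #|L| < m -> startable e S L u v -> ham_path e S u v.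
Proof.
move=> be; have [es ce] := be.
have eF x y : c x = c y -> e x y = false.
  by move=> E; apply/negP => /ce; rewrite E eqxx.
elim/ltn_ind: m S L u v => m IH S L u v mX mY LS uS cu vS cv full deg lm st.
have LSE x : x \in L -> x \in S /\ c x.
  by move/(subsetP LS); rewrite inE => /andP[? /eqP].
have cNeq x y : c x -> ~~ c y -> x != y.
  by move=> cx; apply: contraNneq => <-.
have nbrE x y : c x -> y \in nbr e S x -> [/\ y \in S, e x y & ~~ c y].
  move=> cx; rewrite inE => /andP[yS exy]; split=> //.
  by move/ce: exy; rewrite cx; case: (c y).
have cardL s : s \in L -> #|L| = (#|L :\ s|).+1.
  by move=> sL; rewrite (cardsD1 s) sL.
have fullD S' a : S' \subset S -> a \notin S' -> full_outside e S' (L :\ a).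
  move=> sS aS' x y xS' cx xL yS' cy.
  apply: full => //; try exact: (subsetP sS).
  by apply: contra xL => xL; rewrite !inE xL andbT; apply: contraNneq aS' => <-.
have step1 y0 x0 : u \in L \/ L = set0 -> y0 \in nbr e S u -> y0 != v ->
    x0 \in S -> c x0 -> x0 != u -> e y0 x0 -> 1 < m ->
    startable e (S :\ u :\ y0) (L :\ u) x0 v -> ham_path e S u v.
  move=> uL /(nbrE _ _ cu) [y0S euy cy0] y0v x0S cx0 x0u eyx m1 st'.
  apply: (ham_path_cons uS euy).
  have y0S' : y0 \in S :\ u by rewrite !inE y0S andbT eq_sym cNeq.
  apply: (ham_path_cons y0S' eyx).
  have := card_sideD1 true uS; have := card_sideD1 true y0S'.
  have := card_sideD1 false uS; have := card_sideD1 false y0S'.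
  rewrite mX mY cu (negPf cy0) /= => E1 E2 E3 E4.
  apply: (IH m.-1) st' => //.
  - by case: (m) m1.
  - by move: E1 E2 E3 E4; clear; lia.
  - by move: E1 E2 E3 E4; clear; lia.
  - apply/subsetP => x; rewrite !inE => /andP[xu /LSE [xS cx]].
    by rewrite xS cx xu eqxx andbT (cNeq _ _ cx cy0).
  - by rewrite !inE x0S x0u (cNeq _ _ cx0 cy0).
  - by rewrite !inE vS eq_sym y0v eq_sym (cNeq _ _ cu cv).
  - apply: fullD; last by rewrite !inE eqxx andbF.
    by rewrite !subDset; apply: subsetU; rewrite subsetUr orbT.
  - move=> x; rewrite !inE => /andP[xu xL].
    have [xS cx] := LSE _ xL.
    case: uL => [uL|L0]; last by rewrite L0 inE in xL.
    have := deg _ xL; rewrite (card_nbrD1 _ _ uS) (card_nbrD1 _ _ y0S').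
    rewrite (eF x u) ?cu // (cardL _ uL).
    by move: (e x y0 : nat) (leq_b1 (e x y0)) => ?; clear; lia.
  - case: uL => [uL|->]; last by rewrite set0D cards0; case: (m) m1 => [|[]].
    by move: lm; rewrite (cardL _ uL); clear; lia.
have step2 s y0 : s \in L -> s != u -> e s v -> y0 \in nbr e S s -> y0 != v ->
    startable e (S :\ v :\ s) (L :\ s) u y0 -> ham_path e S u v.
  move=> sL su esv; have [sS cs] := LSE _ sL.
  move=> /(nbrE _ _ cs) [y0S esy cy0] y0v st'.
  apply: (ham_path_rcons es vS esv).
  have sS' : s \in S :\ v by rewrite !inE sS andbT cNeq.
  apply: (ham_path_rcons es sS' (w := y0)); first by rewrite es.
  have := card_sideD1 true vS; have := card_sideD1 true sS'.
  have := card_sideD1 false vS; have := card_sideD1 false sS'.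
  rewrite mX mY cs (negPf cv) /= => E1 E2 E3 E4.
  have m1 : 1 < m by move: lm; rewrite (cardL _ sL); clear; lia.
  apply: (IH m.-1) st' => //.
  - by case: (m) m1.
  - by move: E1 E2 E3 E4; clear; lia.
  - by move: E1 E2 E3 E4; clear; lia.
  - apply/subsetP => x; rewrite !inE => /andP[xu /LSE [xS cx]].
    by rewrite xS cx xu eqxx andbT (cNeq _ _ cx cv).
  - by rewrite !inE uS eq_sym su (cNeq _ _ cu cv).
  - by rewrite !inE y0S y0v eq_sym (cNeq _ _ cs cy0).
  - apply: fullD; last by rewrite !inE eqxx.
    by rewrite !subDset; apply: subsetU; rewrite subsetUr orbT.
  - move=> x; rewrite !inE => /andP[xu xL].
    have [xS cx] := LSE _ xL.
    have := deg _ xL; rewrite (card_nbrD1 _ _ vS) (card_nbrD1 _ _ sS').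
    rewrite (eF x s) ?cs // (cardL _ sL).
    by move: (e x v : nat) (leq_b1 (e x v)) => ?; clear; lia.
  - by move: lm; rewrite (cardL _ sL); clear; lia.
(* Here the path ends with [y0 s y1 x1 v]. Both [y1] and [v] disappear, but [v] has no neighbour in
   [L], so degrees on [L] still drop by at most one. The side length drops by two while [L] loses
   one vertex, which is why [2 * #|L| < m] is the invariant. *)
have step3 s y0 y1 x1 : (forall x, x \in L -> ~~ e x v) ->
    s \in L -> s != u -> y0 \in nbr e S s -> y1 \in nbr e S s -> y0 != y1 ->
    x1 \in S -> c x1 -> x1 \notin L -> x1 != u ->
    startable e (S :\ v :\ x1 :\ y1 :\ s) (L :\ s) u y0 -> ham_path e S u v.
  move=> Lv sL su; have [sS cs] := LSE _ sL.
  move=> /(nbrE _ _ cs) [y0S esy0 cy0] /(nbrE _ _ cs) [y1S esy1 cy1] y01.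
  move=> x1S cx1 x1L x1u st'.
  have y0v : y0 != v by apply: contraTneq esy0 => ->; apply: Lv.
  have y1v : y1 != v by apply: contraTneq esy1 => ->; apply: Lv.
  have x1s : x1 != s by apply: contraNneq x1L => ->.
  apply: (ham_path_rcons es vS (w := x1)); first exact: full.
  have x1S' : x1 \in S :\ v by rewrite !inE x1S andbT cNeq.
  apply: (ham_path_rcons es x1S' (w := y1)); first by rewrite es; exact: full.
  have y1S' : y1 \in S :\ v :\ x1 by rewrite !inE y1S y1v andbT eq_sym cNeq.
  apply: (ham_path_rcons es y1S' esy1).
  have sS' : s \in S :\ v :\ x1 :\ y1.
    by rewrite !inE sS (cNeq s y1) // (cNeq s v) //= andbT eq_sym.
  apply: (ham_path_rcons es sS' (w := y0)); first by rewrite es.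
  have := card_sideD1 true vS; have := card_sideD1 true x1S'.
  have := card_sideD1 true y1S'; have := card_sideD1 true sS'.
  have := card_sideD1 false vS; have := card_sideD1 false x1S'.
  have := card_sideD1 false y1S'; have := card_sideD1 false sS'.
  rewrite mX mY cs cx1 (negPf cv) (negPf cy1) /= => E1 E2 E3 E4 E5 E6 E7 E8.
  have m1 : 2 < m.
    by move: lm; rewrite (cardL _ sL); move: E1 E2 E3 E4 E5 E6 E7 E8; clear; lia.
  apply: (IH m.-2) st' => //.
  - by move: m1; clear; lia.
  - by move: E1 E2 E3 E4 E5 E6 E7 E8; clear; lia.
  - by move: E1 E2 E3 E4 E5 E6 E7 E8; clear; lia.
  - apply/subsetP => x; rewrite !inE => /andP[xs xL]; have [xS cx] := LSE _ xL.
    rewrite xS cx xs eqxx (cNeq x y1) // (cNeq x v) // !andbT /=.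
    by apply: contraNneq x1L => <-.
  - rewrite !inE uS (cNeq u y1) // (cNeq u v) // !andbT /=.
    by rewrite eq_sym su eq_sym.
  - by rewrite !inE y0S y0v y01 eq_sym (cNeq s y0) // eq_sym (cNeq x1 y0).
  - apply: fullD; last by rewrite !inE eqxx.
    by rewrite !subDset; do 4 (apply: subsetU; apply/orP; right).
  - move=> x; rewrite !inE => /andP[xs xL].
    have [xS cx] := LSE _ xL.
    have := deg _ xL; rewrite (card_nbrD1 _ _ vS) (card_nbrD1 _ _ x1S').
    rewrite (card_nbrD1 _ _ y1S') (card_nbrD1 _ _ sS').
    rewrite (eF x s) ?cs // (eF x x1) ?cx1 // (negPf (Lv _ xL)) (cardL _ sL).
    by move: (e x y1 : nat) (leq_b1 (e x y1)) => ?; clear; lia.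
  - by move: lm m1; rewrite (cardL _ sL); clear; lia.
have outside a : 0 < #|L| -> exists x, [/\ x \in S, c x, x \notin L & x != a].
  move=> L0; have /card_gt0P[x] : 0 < #|(side S true :\: L) :\ a|.
    have := cardsD1 a (side S true :\: L).
    have := leq_b1 (a \in side S true :\: L).
    have := cardsID L (side S true); rewrite mX (setIidPr LS).
    by move: lm L0; clear; lia.
  by rewrite !inE => /and4P[xa xL xS /eqP cx]; exists x.
(* If the second vertex [y0] has another neighbour in [L], the path goes there and the same
   situation recurs. If not, the removal of [y0] costs the rest of [L] nothing, and its degrees now
   exceed its size. *)
have third : u \in L -> (forall s, s \in L -> s != u -> ~~ e s v) ->
    (exists2 y, y \in nbr e S u & y != v) -> ham_path e S u v.
  move=> uL Lv [y0 y0N y0v].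
  have [y0S euy cy0] := nbrE _ _ cu y0N.
  have y0S' : y0 \in S :\ u by rewrite !inE y0S andbT eq_sym cNeq.
  have L0 : 0 < #|L| by rewrite (cardL _ uL).
  have m1 : 1 < m by move: lm L0; clear; lia.
  have [/exists_inP [s1 s1L /andP[s1u eys]] | none] :=
      boolP [exists s in L, (s != u) && e y0 s].
    have [s1S cs1] := LSE _ s1L.
    apply: (step1 y0 s1) => //; first by left.
    apply: Or33; split; first by rewrite !inE s1u.
      by move=> s; rewrite !inE => /andP[su sL] _; apply: Lv.
    have /card_gt0P [y yN] : 0 < #|nbr e (S :\ u :\ y0) s1|.
      have := deg _ s1L; rewrite (card_nbrD1 _ _ uS) (card_nbrD1 _ _ y0S').
      rewrite (eF s1 u) ?cu // es eys (cardL _ uL) (cardsD1 s1) !inE s1u s1L.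
      by clear; lia.
    exists y => //; apply: contraTneq yN => ->.
    by rewrite !inE (negPf (Lv _ s1L s1u)) !andbF.
  have [x0 [x0S cx0 x0L x0u]] := outside u L0.
  apply: (step1 y0 x0) => //; first by left.
    by rewrite es; apply: full.
  have [E|[s sL']] := set_0Vmem (L :\ u); first by apply: Or31; rewrite E cards0.
  apply: Or32; exists s => //; move: sL'; rewrite !inE => /andP[su sL].
  have [sS cs] := LSE _ sL.
  have := deg _ sL; rewrite (card_nbrD1 _ _ uS) (card_nbrD1 _ _ y0S').
  rewrite (eF s u) ?cu // (cardL _ uL).
  have -> : e s y0 = false.
    rewrite es; apply: contraNF none => eys.
    by apply/exists_inP; exists s => //; rewrite su.
  by clear; lia.
case: st => [/eqP L0 | [s0 s0L ds0] | [? ? ?]]; last exact: third.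
  have {L0}L0 : L = set0 by apply/eqP; rewrite -cards_eq0.
  have euv : e u v by apply: full; rewrite // L0 inE.
  have [m1|m1] := ltnP 1 m.
    have [y0] : exists2 y, y \in side S false & y != v.
      by apply: card_gt1_neq; rewrite mY.
    rewrite inE => /andP[y0S /eqP cy0] y0v.
    have [x0] : exists2 y, y \in side S true & y != u.
      by apply: card_gt1_neq; rewrite mX.
    rewrite inE => /andP[x0S /eqP cx0] x0u.
    apply: (step1 y0 x0) => //; first by right.
    - by rewrite inE y0S full // ?L0 ?inE // cy0.
    - by rewrite es full // ?L0 ?inE // cy0.
    - by apply: Or31; rewrite L0 set0D cards0.
  have S2 : S :\ u :\ v = set0.
    apply/eqP; rewrite -cards_eq0.
    have := card_side S; rewrite mX mY (cardsD1 u) uS (cardsD1 v) !inE vS.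
    by rewrite eq_sym cNeq //=; move: m1; clear; lia.
  apply: (ham_path_cons uS euv); exists [::]; split=> // x.
  rewrite mem_seq1; move/setP/(_ x): S2; rewrite !inE.
  case: eqVneq => [->|] //=.
  by rewrite vS eq_sym cNeq.
have Lpos : 0 < #|L| by rewrite (cardL _ s0L).
have m1 : 1 < m by move: lm Lpos; clear; lia.
have two s : s \in L -> s != s0 -> 1 < #|nbr e S s|.
  move=> sL ss0; apply: leq_trans (deg _ sL).
  by rewrite (cardL _ s0L) (cardsD1 s) !inE ss0 sL.
have [s0S cs0] := LSE _ s0L.
(* Removing [v] and [s] lowers the degree of [s0] by at most one and the size of the set by one, so
   [s0] still has a neighbour to spare. *)
have atv s : s \in L -> s != s0 -> s != u -> e s v -> ham_path e S u v.
  move=> sL ss0 su esv; have [sS cs] := LSE _ sL.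
  have [y0 y0N y0v] := card_gt1_neq v (two _ sL ss0).
  apply: (step2 s y0) => //; apply: Or32; exists s0.
    by rewrite !inE s0L eq_sym ss0.
  have sS' : s \in S :\ v by rewrite !inE sS andbT cNeq.
  move: ds0; rewrite (card_nbrD1 _ _ vS) (card_nbrD1 _ _ sS').
  rewrite (eF s0 s) ?cs // (cardL _ sL).
  by move: (e s0 v : nat) (leq_b1 (e s0 v)) => ?; clear; lia.
have [/exists_inP [s sL /and3P[ss0 su esv]] | none] :=
    boolP [exists s in L, [&& s != s0, s != u & e s v]].
  exact: (atv s).
have {}none s : s \in L -> s != s0 -> s != u -> ~~ e s v.
  move=> sL ss0 su; apply: contra none => esv.
  by apply/exists_inP; exists s => //; rewrite ss0 su.
have d0 : 1 < #|nbr e S s0| by apply: leq_ltn_trans ds0.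
have [uL|uL] := boolP (u \in L).
  have [us0|us0] := eqVneq u s0.
    apply: third => //; last by rewrite us0; apply: card_gt1_neq.
    by move=> s sL su; apply: none; rewrite -?us0.
  have [y0 y0N y0v] := card_gt1_neq v (two _ uL us0).
  have [y0S euy cy0] := nbrE _ _ cu y0N.
  have y0S' : y0 \in S :\ u by rewrite !inE y0S andbT eq_sym cNeq.
  have [x0 [x0S cx0 x0L x0u]] := outside u Lpos.
  apply: (step1 y0 x0) => //; first by left.
    by rewrite es; apply: full.
  apply: Or32; exists s0; first by rewrite !inE eq_sym us0.
  move: ds0; rewrite (card_nbrD1 _ _ uS) (card_nbrD1 _ _ y0S').
  rewrite (eF s0 u) ?cu // (cardL _ uL).
  by move: (e s0 y0 : nat) (leq_b1 (e s0 y0)) => ?; clear; lia.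
have Lu s : s \in L -> s != u by move=> sL; apply: contraNneq uL => <-.
(* If [s0] itself is placed next to [v], any other vertex of [L] takes over its role: it is not
   adjacent to [v], so it keeps its degree while the set shrinks. *)
have [es0v|es0v] := boolP (e s0 v).
  have [y0 y0N y0v] := card_gt1_neq v d0.
  apply: (step2 s0 y0) => //; first exact: Lu.
  have [E|[s sL']] := set_0Vmem (L :\ s0); first by apply: Or31; rewrite E cards0.
  apply: Or32; exists s => //; move: sL'; rewrite !inE => /andP[ss0 sL].
  have [sS cs] := LSE _ sL.
  have s0S' : s0 \in S :\ v by rewrite !inE s0S andbT cNeq.
  have := deg _ sL; rewrite (card_nbrD1 _ _ vS) (card_nbrD1 _ _ s0S').
  by rewrite (eF s s0) ?cs0 // (cardL _ s0L) (negPf (none _ sL ss0 (Lu _ sL))).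
have Lv s : s \in L -> ~~ e s v.
  by move=> sL; have [->|ss0] := eqVneq s s0; last exact: (none _ _ _ (Lu _ sL)).
(* A vertex other than [s0] is used if there is one, so that [s0] remains available; otherwise [L]
   becomes empty. *)
have [s [sL ds ss0]] : exists s, [/\ s \in L, 1 < #|nbr e S s| & s = s0 -> L :\ s = set0].
  have [E|[s sL']] := set_0Vmem (L :\ s0); first by exists s0.
  move: sL'; rewrite !inE => /andP[ss0 sL]; exists s; split=> //; first exact: two.
  by move=> E; rewrite E eqxx in ss0.
have [sS cs] := LSE _ sL.
have [y0 y0N y0v] := card_gt1_neq v ds.
have [y1 y1N y10] := card_gt1_neq y0 ds.
have [x1 [x1S cx1 x1L x1u]] := outside u Lpos.
apply: (step3 s y0 y1 x1) => //; [exact: Lu | by rewrite eq_sym |].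
have [Es|ns] := eqVneq s s0; first by apply: Or31; rewrite ss0 // cards0.
apply: Or32; exists s0; first by rewrite !inE eq_sym ns.
have [y1S esy1 cy1] := nbrE _ _ cs y1N.
have x1S' : x1 \in S :\ v by rewrite !inE x1S andbT cNeq.
have y1v : y1 != v by apply: contraTneq esy1 => ->; apply: Lv.
have y1S' : y1 \in S :\ v :\ x1 by rewrite !inE y1S y1v andbT eq_sym cNeq.
have sS' : s \in S :\ v :\ x1 :\ y1.
  rewrite !inE sS (cNeq s y1) // (cNeq s v) //= andbT.
  by apply: contraNneq x1L => <-.
move: ds0; rewrite (card_nbrD1 _ _ vS) (card_nbrD1 _ _ x1S').
rewrite (card_nbrD1 _ _ y1S') (card_nbrD1 _ _ sS').
rewrite (eF s0 s) ?cs // (eF s0 x1) ?cx1 // (negPf es0v) (cardL _ sL).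
by move: (e s0 y1 : nat) (leq_b1 (e s0 y1)) => ?; clear; lia.
Qed.

End Bipartite.

Section ColourSwap.
Variables (V : finType) (c : pred V).

(** Negating the colouring exchanges the two sides, so that results with the exceptional set on the
    first side apply to the second. *)
Lemma bipartite_predC e : bipartite c e -> bipartite (predC c) e.
Proof.
by move=> [es ce]; split=> // x y /ce /=; case: (c x); case: (c y).
Qed.

Lemma side_predC S b : side (predC c) S b = side c S (~~ b).
Proof. by apply/setP => x; rewrite !inE /=; case: (c x); case: b. Qed.

End ColourSwap.

(** * Explicit paths for few exceptional vertices, and matchings of nonadjacent pairs *)

Section Structure.
Variables (V : finType) (c : pred V).
Implicit Types (e : rel V) (S L : {set V}) (u v x y : V) (M : seq (V * V)).

(** If [L] is nonempty and none of its vertices has more than [#|L|] neighbours, each degree on [L]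
    is squeezed between [t] and [#|L| <= t]. *)
Lemma ham_path_or_low_set e m t S L u v :
  bipartite c e -> #|side c S true| = m -> #|side c S false| = m ->
  L \subset side c S true -> u \in S -> c u -> v \in S -> ~~ c v ->
  full_outside c e S L -> (forall x, x \in L -> t <= #|nbr e S x|) ->
  #|L| <= t -> 2 * t < m ->
  ham_path e S u v \/ (#|L| = t /\ forall x, x \in L -> #|nbr e S x| <= t).
Proof.
move=> be mX mY LS uS cu vS cv full deg Lt tm.
have deg' x : x \in L -> #|L| <= #|nbr e S x| by move/deg; apply: leq_trans.
have lm : 2 * #|L| < m by move: Lt tm; clear; lia.
have ham := ham_path_full_outside be mX mY LS uS cu vS cv full deg' lm.
have [/exists_inP[s sL ds]|none] := boolP [exists s in L, #|L| < #|nbr e S s|].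
  by left; apply: ham; apply: Or32; exists s.
have {}none x : x \in L -> #|nbr e S x| <= #|L|.
  move=> xL; rewrite leqNgt; apply: contra none => ?.
  by apply/exists_inP; exists x.
have [L0|[s sL]] := set_0Vmem L.
  by left; apply: ham; apply: Or31; rewrite L0 cards0.
have E : #|L| = t by apply/eqP; rewrite eqn_leq Lt (leq_trans (deg _ sL)) ?none.
by right; split=> // x /none; rewrite E.
Qed.

Lemma ham_path_one_low e m S y1 u v :
  bipartite c e -> #|side c S true| = m -> #|side c S false| = m ->
  y1 \in S -> ~~ c y1 -> u \in S -> c u -> v \in S -> ~~ c v ->
  (forall x y, x \in S -> c x -> y \in S -> ~~ c y -> y != y1 -> e x y) ->
  1 < #|nbr e S y1| -> 2 < m -> ham_path e S u v.
Proof.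
move=> be mX mY y1S cy1 uS cu vS cv full dy m2; have [es ce] := be.
apply: ham_path_sym => //.
apply: (@ham_path_full_outside _ (predC c) e m S [set y1]) => //=.
- exact: bipartite_predC.
- by rewrite side_predC.
- by rewrite side_predC.
- by apply/subsetP => x; rewrite !inE => /eqP->; rewrite y1S (negPf cy1).
- by rewrite negbK.
- move=> x y xS /= cx; rewrite inE negbK => xy1 yS cy; rewrite es; exact: full.
- by move=> x; rewrite inE cards1 => /eqP->; apply: ltnW.
- by rewrite cards1.
- by apply: Or32; exists y1; rewrite ?inE ?cards1.
Qed.

(** The low vertex [x1] is used up as the first vertex. It is not adjacent to [y1], so [y1] keeps
    its degree and becomes the only low vertex. *)
Lemma ham_path_two_low_start e m S x1 y1 v :
  bipartite c e -> #|side c S true| = m -> #|side c S false| = m ->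
  x1 \in S -> c x1 -> y1 \in S -> ~~ c y1 -> v \in S -> ~~ c v ->
  (forall x y, x \in S -> c x -> x != x1 -> y \in S -> ~~ c y -> y != y1 -> e x y) ->
  ~~ e x1 y1 -> 1 < #|nbr e S x1| -> 1 < #|nbr e S y1| -> 3 < m ->
  ham_path e S x1 v.
Proof.
move=> be mX mY x1S cx1 y1S cy1 vS cv full nexy dx dy m3; have [es ce] := be.
have cNeq x y : c x -> ~~ c y -> x != y by move=> cx; apply: contraNneq => <-.
have [y0 y0N y0v] := card_gt1_neq v dx.
move: y0N; rewrite inE => /andP[y0S exy0].
have cy0 : ~~ c y0 by move/ce: exy0; rewrite cx1; case: (c y0).
have y0y1 : y0 != y1 by apply: contraTneq exy0 => ->.
have [x0] : exists2 y, y \in side c S true & y != x1.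
  by apply: card_gt1_neq; rewrite mX; move: m3; clear; lia.
rewrite inE => /andP[x0S /eqP cx0] x0x1.
apply: (ham_path_cons x1S exy0).
have y0S' : y0 \in S :\ x1 by rewrite !inE y0S andbT eq_sym cNeq.
apply: (ham_path_cons y0S' (w := x0)); first by rewrite es full.
have := card_sideD1 c true x1S; have := card_sideD1 c true y0S'.
have := card_sideD1 c false x1S; have := card_sideD1 c false y0S'.
rewrite mX mY cx1 (negPf cy0) /= => E1 E2 E3 E4.
apply: (@ham_path_one_low e m.-1 _ y1) => //.
- by move: E1 E2 E3 E4; clear; lia.
- by move: E1 E2 E3 E4; clear; lia.
- by rewrite !inE y1S eq_sym y0y1 eq_sym cNeq.
- by rewrite !inE x0S x0x1 cNeq.
- by rewrite !inE vS eq_sym y0v eq_sym cNeq.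
- move=> x y; rewrite !inE => /and3P[_ xx1 xS] cx /and3P[_ _ yS] cy yy1.
  exact: full.
- move: dy; rewrite (card_nbrD1 _ _ x1S) (card_nbrD1 _ _ y0S').
  rewrite es (negPf nexy); have -> : e y1 y0 = false; last by [].
  by apply/negP => /ce; rewrite (negPf cy1) (negPf cy0).
- by move: m3; clear; lia.
Qed.

(** The vertex [x1] is placed near the end: the path closes with [y0 x1 v] if [x1] is adjacent to
    [v], and with [y0 x1 y2 x' v] otherwise. The removed vertices on the side of [x1] are
    nonneighbours of [y1], so its degree two survives for [ham_path_one_low]. *)
Lemma ham_path_two_low_inner e m S x1 y1 u v :
  bipartite c e -> #|side c S true| = m -> #|side c S false| = m ->
  x1 \in S -> c x1 -> y1 \in S -> ~~ c y1 ->
  u \in S -> c u -> v \in S -> ~~ c v -> u != x1 -> v != y1 ->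
  (forall x y, x \in S -> c x -> x != x1 -> y \in S -> ~~ c y -> y != y1 -> e x y) ->
  ~~ e x1 y1 -> 1 < #|nbr e S x1| -> #|nbr e S y1| = 2 -> 4 < m ->
  ham_path e S u v.
Proof.
move=> be mX mY x1S cx1 y1S cy1 uS cu vS cv ux1 vy1 full nexy dx dy m3.
have [es ce] := be.
have cNeq x y : c x -> ~~ c y -> x != y by move=> cx; apply: contraNneq => <-.
have eF x y : c x = c y -> e x y = false.
  by move=> E; apply/negP => /ce; rewrite E eqxx.
have [y0 y0N y0v] := card_gt1_neq v dx.
move: y0N; rewrite inE => /andP[y0S exy0].
have cy0 : ~~ c y0 by move/ce: exy0; rewrite cx1; case: (c y0).
have y0y1 : y0 != y1 by apply: contraTneq exy0 => ->.
have [exv|exv] := boolP (e x1 v).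
  apply: (ham_path_rcons es vS exv).
  have x1S' : x1 \in S :\ v by rewrite !inE x1S andbT cNeq.
  apply: (ham_path_rcons es x1S' (w := y0)); first by rewrite es.
  have := card_sideD1 c true vS; have := card_sideD1 c true x1S'.
  have := card_sideD1 c false vS; have := card_sideD1 c false x1S'.
  rewrite mX mY cx1 (negPf cv) /= => E1 E2 E3 E4.
  apply: (@ham_path_one_low e m.-1 _ y1) => //.
  - by move: E1 E2 E3 E4; clear; lia.
  - by move: E1 E2 E3 E4; clear; lia.
  - by rewrite !inE y1S eq_sym cNeq // eq_sym vy1.
  - by rewrite !inE uS ux1 cNeq.
  - by rewrite !inE y0S y0v eq_sym cNeq.
  - move=> x y; rewrite !inE => /and3P[xx1 _ xS] cx /and3P[_ _ yS] cy yy1.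
    exact: full.
  - move: dy; rewrite (card_nbrD1 _ _ vS) (card_nbrD1 _ _ x1S').
    by rewrite (eF y1 v) ?(negPf cv) ?(negPf cy1) // es (negPf nexy) !add0n => ->.
  - by move: m3; clear; lia.
have [y2 y2N y20] := card_gt1_neq y0 dx.
move: y2N; rewrite inE => /andP[y2S exy2].
have cy2 : ~~ c y2 by move/ce: exy2; rewrite cx1; case: (c y2).
have y2y1 : y2 != y1 by apply: contraTneq exy2 => ->.
have y2v : y2 != v by apply: contraTneq exy2 => ->.
(* [x'] avoids [x1], [u] and the two neighbours of [y1], hence the condition [4 < m]. *)
have [x' ] : exists x', x' \in (side c S true :\: nbr e S y1) :\ x1 :\ u.
  apply/card_gt0P.
  have := cardsD1 u ((side c S true :\: nbr e S y1) :\ x1).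
  have := leq_b1 (u \in (side c S true :\: nbr e S y1) :\ x1).
  have := cardsD1 x1 (side c S true :\: nbr e S y1).
  have := leq_b1 (x1 \in side c S true :\: nbr e S y1).
  have := cardsID (nbr e S y1) (side c S true); rewrite mX.
  have := subset_leq_card (subsetIr (side c S true) (nbr e S y1)); rewrite dy.
  by move: m3; clear; lia.
rewrite !inE => /and5P[x'u x'x1 x'y1 x'S /eqP cx'].
rewrite x'S /= in x'y1.
apply: (ham_path_rcons es vS (w := x')); first exact: full.
have x'S' : x' \in S :\ v by rewrite !inE x'S andbT cNeq.
apply: (ham_path_rcons es x'S' (w := y2)); first by rewrite es; exact: full.
have y2S' : y2 \in S :\ v :\ x' by rewrite !inE y2S y2v andbT eq_sym cNeq.
apply: (ham_path_rcons es y2S' exy2).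
have x1S' : x1 \in S :\ v :\ x' :\ y2.
  by rewrite !inE x1S (cNeq x1 y2) // (cNeq x1 v) //= andbT eq_sym.
apply: (ham_path_rcons es x1S' (w := y0)); first by rewrite es.
have := card_sideD1 c true vS; have := card_sideD1 c true x'S'.
have := card_sideD1 c true y2S'; have := card_sideD1 c true x1S'.
have := card_sideD1 c false vS; have := card_sideD1 c false x'S'.
have := card_sideD1 c false y2S'; have := card_sideD1 c false x1S'.
rewrite mX mY cx1 cx' (negPf cv) (negPf cy2) /= => E1 E2 E3 E4 E5 E6 E7 E8.
apply: (@ham_path_one_low e m.-2 _ y1) => //.
- by move: E1 E2 E3 E4 E5 E6 E7 E8; clear; lia.
- by move: E1 E2 E3 E4 E5 E6 E7 E8; clear; lia.
- rewrite !inE y1S eq_sym cNeq // eq_sym y2y1 eq_sym cNeq //=.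
  by rewrite eq_sym vy1.
- rewrite !inE uS ux1 (cNeq u y2) // (cNeq u v) //= andbT.
  by rewrite eq_sym.
- by rewrite !inE y0S y0v eq_sym cNeq // eq_sym y20 eq_sym cNeq.
- move=> x y; rewrite !inE => /and5P[xx1 _ _ _ xS] cx /and5P[_ _ _ _ yS] cy yy1.
  exact: full.
- move: dy; rewrite (card_nbrD1 _ _ vS) (card_nbrD1 _ _ x'S').
  rewrite (card_nbrD1 _ _ y2S') (card_nbrD1 _ _ x1S').
  rewrite (eF y1 v) ?(negPf cv) ?(negPf cy1) // (negPf x'y1).
  rewrite (eF y1 y2) ?(negPf cy2) ?(negPf cy1) // es (negPf nexy).
  by rewrite !add0n => ->.
- by move: m3; clear; lia.
Qed.

Definition nonedges e S := \sum_(x in side c S true) #|nonnbr c e S x|.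

Definition nonedge e S x y :=
  [&& x \in side c S true, y \in side c S false & ~~ e x y].

(** A matching of the bipartite complement of [e] on [S]. *)
Definition matching e S M :=
  [&& uniq (unzip1 M), uniq (unzip2 M) & all (fun p => nonedge e S p.1 p.2) M].

(** A nonadjacent pair is counted twice on the left only if both its ends are matched, and there are
    at most [size M * size M] such pairs. *)
Lemma matching_nonedges e S M : symmetric e -> matching e S M ->
  \sum_(p <- M) (#|nonnbr c e S p.1| + #|nonnbr c e S p.2|)
    <= nonedges e S + size M * size M.
Proof.
move=> es /and3P[u1 u2 /allP aM].
have E1 : \sum_(p <- M) #|nonnbr c e S p.1| =
          \sum_(x in side c S true | x \in unzip1 M) #|nonnbr c e S x|.
  rewrite -(big_map fst xpredT (fun x => #|nonnbr c e S x|)) /= big_uniq //=.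
  apply: eq_bigl => x; apply/idP/andP => [xM|[]//]; split=> //.
  by case/mapP: xM => p /aM /and3P[pX _ _] ->.
have E2 : \sum_(p <- M) #|nonnbr c e S p.2| =
          \sum_(x in side c S true) \sum_(p <- M) ~~ e x p.2.
  rewrite exchange_big /= big_seq [RHS]big_seq; apply: eq_bigr => p.
  move=> /aM /and3P[_]; rewrite inE => /andP[p2S /eqP cp] _.
  rewrite -sum1_card [RHS]big_mkcond [LHS]big_mkcond /=.
  apply: eq_bigr => x _; rewrite !inE cp es.
  by case: (x \in S); case: (c x); case: (e x p.2).
rewrite big_split /= E1 E2 /nonedges.
rewrite [X in _ <= X + _](bigID (fun x => x \in unzip1 M)) /=.
rewrite -addnA leq_add2l addnC (bigID (fun x => x \in unzip1 M)) /=.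
apply: leq_add.
  apply: leq_trans (_ : \sum_(x in side c S true | x \in unzip1 M) size M <= _).
    apply: leq_sum => x _; rewrite -sum1_size; apply: leq_sum => p _.
    exact: leq_b1.
  rewrite sum_nat_const leq_mul2r; apply/orP; right.
  rewrite -(size_map fst M) -(card_uniqP u1).
  by apply: subset_leq_card; apply/subsetP => x /andP[].
apply: leq_sum => x; rewrite inE => /andP[/andP[xS /eqP cx] _].
have -> : \sum_(p <- M) ~~ e x p.2 = count (fun y => ~~ e x y) (unzip2 M).
  by rewrite count_map -sum1_count [RHS]big_mkcond;
     apply: eq_bigr => p _; rewrite /=; case: (e x p.2).
rewrite -size_filter -(card_uniqP (filter_uniq _ u2)).
apply: subset_leq_card; apply/subsetP => y.
rewrite mem_filter => /andP[exy /mapP[p /aM /and3P[_ + _] E]].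
by rewrite !inE -E cx exy => /andP[-> /eqP ->].
Qed.

(** Vertices with more than [t] nonneighbours always find one outside a matching of size at most
    [t]. An unmatched such vertex therefore gives a new pair. If all of them are matched, there are
    more of them than pairs, so some pair of [M] has both ends among them; it is replaced by two
    pairs, as along an augmenting path of length three. *)
Lemma matching_augment e S M t : symmetric e -> matching e S M -> size M <= t ->
  size M < #|[set x in S | t < #|nonnbr c e S x|]| ->
  exists2 M', matching e S M' & size M' = (size M).+1.
Proof.
move=> es mM Mt; set L := [set x in S | _] => ML.
have [u1 u2 aM] := and3P mM.
have pick (r : seq V) x : size r = size M -> x \in L ->
    exists y, [/\ y \in S, c y != c x, ~~ e x y & y \notin r].
  move=> sr; rewrite inE => /andP[xS dx].
  have /card_gt0P[y] : 0 < #|nonnbr c e S x :\: [set y in r]|.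
    have := cardsID [set y in r] (nonnbr c e S x).
    have := subset_leq_card (subsetIr (nonnbr c e S x) [set y in r]).
    have : #|[set y in r]| <= size r.
      by rewrite cardsE card_size.
    by move: Mt dx; rewrite sr; clear; lia.
  by rewrite !inE => /and4P[yr yS cy exy]; exists y.
have LE x : x \in L -> x \in S by rewrite inE => /andP[].
have [/existsP[x /andP[xL /norP[x1 x2]]]|cov] :=
    boolP [exists x, (x \in L) && ~~ ((x \in unzip1 M) || (x \in unzip2 M))].
  case cx: (c x).
    have [y [yS cy exy yr]] := pick (unzip2 M) x (size_map _ _) xL.
    exists ((x, y) :: M) => //; rewrite /matching /= x1 yr u1 u2 /= aM andbT.
    rewrite /nonedge !inE (LE _ xL) cx yS exy /=.
    by move: cy; rewrite cx; case: (c y).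
  have [y [yS cy exy yr]] := pick (unzip1 M) x (size_map _ _) xL.
  exists ((y, x) :: M) => //; rewrite /matching /= x2 yr u1 u2 /= aM andbT.
  rewrite /nonedge !inE (LE _ xL) cx yS es exy /= andbT.
  by move: cy; rewrite cx; case: (c y).
have [/hasP[[x y] pM /andP[/= xL yL]]|none] :=
    boolP (has (fun p => (p.1 \in L) && (p.2 \in L)) M); last first.
  have LX : #|side c L true| <= count (fun p => p.1 \in L) M.
    rewrite -(count_map fst (mem L)) -size_filter -(card_uniqP (filter_uniq _ u1)).
    apply: subset_leq_card; apply/subsetP => x.
    rewrite inE mem_filter => /andP[xL /eqP cx].
    rewrite [mem L x]xL /=; apply: contraNT cov => x1; apply/existsP; exists x.
    rewrite xL negb_or x1 /=; apply/negP => /mapP[p /(allP aM) /and3P[_ + _] E].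
    by rewrite inE -E cx andbF.
  have LY : #|side c L false| <= count (fun p => p.2 \in L) M.
    rewrite -(count_map snd (mem L)) -size_filter -(card_uniqP (filter_uniq _ u2)).
    apply: subset_leq_card; apply/subsetP => x.
    rewrite inE mem_filter => /andP[xL /eqP cx].
    rewrite [mem L x]xL /=; apply: contraNT cov => x1; apply/existsP; exists x.
    rewrite xL negb_or x1 andbT /=; apply/negP => /mapP[p /(allP aM) /and3P[+ _ _] E].
    by rewrite inE -E cx andbF.
  have := count_predUI (fun p => p.1 \in L) (fun p => p.2 \in L) M.
  have -> : count (predI (fun p => p.1 \in L) (fun p => p.2 \in L)) M = 0.
    by apply/eqP; rewrite -leqn0 leqNgt -has_count.
  have := count_size (predU (fun p => p.1 \in L) (fun p => p.2 \in L)) M.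
  move: ML LX LY; rewrite (card_side c L).
  move: (count _ _) (count _ _) (count _ _) => n1 n2 n3; clear; lia.
have [y' [y'S cy' exy' y'r]] := pick (unzip2 M) x (size_map _ _) xL.
have [x' [x'S cx' exy'' x'r]] := pick (unzip1 M) y (size_map _ _) yL.
have := perm_to_rem pM; set M0 := rem _ _ => pe.
have /and3P[pX pY _] := allP aM _ pM.
exists ((x, y') :: (x', y) :: M0); last by rewrite (perm_size pe).
have p1 : perm_eq (unzip1 M) (x :: unzip1 M0) by have := perm_map fst pe.
have p2 : perm_eq (unzip2 M) (y :: unzip2 M0) by have := perm_map snd pe.
move: u1 u2 x'r y'r aM.
rewrite (perm_uniq p1) (perm_uniq p2) (perm_mem p1) (perm_mem p2) (perm_all _ pe).
rewrite /= !inE !negb_or => /andP[xM0 u1] /andP[yM0 u2] /andP[x'x x'M] /andP[y'y y'M].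
move=> /andP[_ aM].
rewrite /matching /= !inE !negb_or eq_sym x'x xM0 x'M u1 y'y y'M yM0 u2 aM /=.
move: pX pY; rewrite /nonedge !inE => /andP[/= xS /eqP cx] /andP[/= yS /eqP cy].
rewrite cx in cy'; rewrite cy in cx'.
rewrite xS cx yS cy y'S x'S exy' es exy'' /= !andbT.
by move: cx' cy'; case: (c x'); case: (c y').
Qed.

Lemma exists_matching e S t r : symmetric e -> r <= t.+1 ->
  t < #|[set x in S | t < #|nonnbr c e S x|]| ->
  exists2 M, matching e S M & size M = r.
Proof.
move=> es; elim: r => [_ _|r IH rt Lt]; first by exists [::].
have [M mM sM] := IH (ltnW rt) Lt.
rewrite -sM; apply: (@matching_augment _ _ _ t) => //; rewrite sM //.
exact: leq_ltn_trans Lt.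
Qed.

End Structure.

(** * Hamiltonian path or exceptional degrees *)

Section Dichotomy.
Variables (V : finType) (c : pred V).
Implicit Types (e : rel V) (S L : {set V}) (u v x y : V).

Definition has_low_set e S t :=
  exists b L, [/\ L \subset side c S b, #|L| = t &
    forall x, x \in L -> #|nbr e S x| <= t].

(** Each of [x] and [y] has at most one neighbour besides the other. Inserting the partner into the
    neighbourhood makes this inherited by subgraphs, even when the edge [x y] itself belongs only to
    the closure. *)
Definition has_low_pair e S :=
  exists x y, [/\ x \in side c S true, y \in side c S false,
    #|y |: nbr e S x| <= 2 & #|x |: nbr e S y| <= 2].

Lemma card_nonnbr e S x : bipartite c e -> x \in S ->
  #|nbr e S x| + #|nonnbr c e S x| = #|side c S (~~ c x)|.
Proof.
move=> [_ ce] xS; rewrite -(cardsID [set y | e x y] (side c S (~~ c x))).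
congr (_ + _); apply: eq_card => y; rewrite !inE.
  by case exy: (e x y); rewrite ?andbF //; move/ce: exy; case: (c x); case: (c y);
     rewrite ?andbT.
by case: (e x y); rewrite ?andbF ?andbT //=; case: (c x); case: (c y).
Qed.

Lemma nonedges_add_edge e S x y : nonedge c e S x y ->
  nonedges c (add_edge e x y) S < nonedges c e S.
Proof.
case/and3P=> xS yS exy; rewrite /nonedges (bigD1 x) //= [X in _ < X](bigD1 x) //=.
have sub z : nonnbr c (add_edge e x y) S z \subset nonnbr c e S z.
  apply/subsetP => w; rewrite !inE => /and3P[-> ->] /=.
  by apply: contra; rewrite /add_edge => ->.
rewrite -addSn; apply: leq_add; last first.
  by apply: leq_sum => z _; apply: subset_leq_card.
apply: proper_card; rewrite properE sub; apply/subsetPn; exists y.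
  by move: xS yS; rewrite !inE exy => /andP[_ /eqP->] /andP[-> /eqP->].
by rewrite !inE /add_edge !eqxx orbT !andbF.
Qed.

(** Induction on the number of nonadjacent pairs carries out the closure. In a closed graph the
    exceptional set [L] consists of the vertices with more than [t] nonneighbours: two nonadjacent
    vertices outside it would have at most [2 * t] nonneighbours together, whereas closedness
    demands at least [m - 1]. *)
Lemma ham_path_or_low e m t N S u v :
  bipartite c e -> #|side c S true| = m -> #|side c S false| = m ->
  u \in S -> c u -> v \in S -> ~~ c v ->
  (forall x, x \in S -> t <= #|nbr e S x|) ->
  nonedges c e S < N -> N + t.+1 * t.+2 <= t.+1 * m -> 2 * t + 1 < m -> 4 < m ->
  [\/ ham_path e S u v, has_low_set e S t | t = 2 /\ has_low_pair e S].
Proof.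
move=> be mX mY uS cu vS cv deg neN Nm tm m4.
have mS b : #|side c S b| = m by case: b.
have [k] := ubnP (nonedges c e S); elim: k e be deg neN => // k IH e be deg neN nek.
have [es ce] := be.
have [/existsP[x /existsP[y /andP[nxy dxy]]]|closed] := boolP
    [exists x, exists y, nonedge c e S x y && (m + 2 <= #|nbr e S x| + #|nbr e S y|)].
  have lt := nonedges_add_edge nxy.
  have /and3P[] := nxy; rewrite !inE => /andP[xS /eqP cx] /andP[yS /eqP cy] exy.
  have cxy : c x != c y by rewrite cx cy.
  have sub z : nbr e S z \subset nbr (add_edge e x y) S z.
    by apply/subsetP => w; rewrite !inE /add_edge => /andP[-> ->].
  have [||||ham|[b [L [LS Lt dL]]]|[t2 [x' [y' [x'S y'S d1 d2]]]]] :=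
      IH (add_edge e x y).
  - exact: bipartite_add_edge.
  - by move=> z zS; apply: leq_trans (deg _ zS) _; apply: subset_leq_card.
  - exact: ltn_trans neN.
  - exact: leq_trans lt nek.
  - by apply: Or31; apply: (bondy_chvatal be cx (negbT cy) cu cv mX mY dxy exy ham).
  - apply: Or32; exists b, L; split=> // z /dL; apply: leq_trans.
    exact: subset_leq_card.
  - apply: Or33; split=> //; exists x', y'; split=> //.
    + by apply: leq_trans d1; apply: subset_leq_card; apply: setUS.
    + by apply: leq_trans d2; apply: subset_leq_card; apply: setUS.
have {}closed x y : nonedge c e S x y -> #|nbr e S x| + #|nbr e S y| <= m + 1.
  move=> nxy; rewrite leqNgt; apply: contra closed => dxy.
  apply/existsP; exists x; apply/existsP; exists y; rewrite nxy.
  by move: dxy; clear; lia.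
have nn x : x \in S -> #|nbr e S x| + #|nonnbr c e S x| = m.
  by move=> xS; rewrite card_nonnbr.
have closedN x y : nonedge c e S x y -> m <= #|nonnbr c e S x| + #|nonnbr c e S y| + 1.
  move=> nxy; have := closed _ _ nxy.
  case/and3P: nxy; rewrite !inE => /andP[/nn + _] /andP[/nn + _] _.
  by clear; lia.
set L := [set x in S | t < #|nonnbr c e S x|].
have Lt : #|L| <= t.
  rewrite leqNgt; apply/negP => tL.
  have [M mM sM] := exists_matching es (leqnn t.+1) tL.
  have := matching_nonedges es mM; rewrite sM.
  have : \sum_(p <- M) (m - 1) <=
         \sum_(p <- M) (#|nonnbr c e S p.1| + #|nonnbr c e S p.2|).
    rewrite big_seq [X in _ <= X]big_seq; apply: leq_sum => p pM.
    have /and3P[_ _ /allP /(_ _ pM) /closedN] := mM.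
    by clear; lia.
  rewrite big_const_seq iter_addn_0 count_predT sM.
  by move: neN Nm tm; clear; nia.
have LS x : x \in L -> x \in S by rewrite inE => /andP[].
set LX := side c L true; set LY := side c L false.
have LXY : #|LX| + #|LY| <= t by rewrite -card_side.
have full x y : x \in S -> c x -> x \notin L -> y \in S -> ~~ c y -> y \notin L -> e x y.
  move=> xS cx xL yS cy yL; apply: contraTT tm => exy.
  have := closedN x y; rewrite /nonedge !inE xS cx yS (negPf cy) exy => /(_ isT).
  move: xL yL; rewrite !inE xS yS /= -!leqNgt; clear; lia.
have degX x : x \in S -> c x -> x \notin L -> m <= #|nbr e S x| + #|LY|.
  move=> xS cx xL; rewrite -(nn _ xS) leq_add2l; apply: subset_leq_card.
  apply/subsetP => y; rewrite !inE cx => /and3P[yS cy exy].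
  have {}cy : ~~ c y by case: (c y) cy.
  rewrite (negPf cy) eqxx andbT; apply: contraNT exy => yL; apply: full => //.
  by rewrite inE.
have degY y : y \in S -> ~~ c y -> y \notin L -> m <= #|nbr e S y| + #|LX|.
  move=> yS cy yL; rewrite -(nn _ yS) leq_add2l; apply: subset_leq_card.
  apply/subsetP => x; rewrite !inE (negPf cy) => /and3P[xS cx exy].
  have {}cx : c x by case: (c x) cx.
  rewrite cx eqxx andbT; apply: contraNT exy => xL; rewrite es; apply: full => //.
  by rewrite inE.
(* If no vertex of [LY] has a nonneighbour outside [L], then [LX] alone meets every nonadjacent pair
   and [ham_path_or_low_set] applies. The next case is the same with the colours exchanged. *)
have [/existsP[x /existsP[y /and3P[nxy xL yL]]]|noXY] := boolP
    [exists x, exists y, [&& nonedge c e S x y, x \notin L & y \in L]]; last first.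
  have LXS : LX \subset side c S true.
    by apply/subsetP => x; rewrite !inE => /andP[/andP[-> _] ->].
  have fo : full_outside c e S LX.
    move=> x y xS cx xL yS cy.
    have {}xL : x \notin L by apply: contra xL => xL; rewrite inE xL cx.
    apply: contraNT noXY => exy; apply/existsP; exists x; apply/existsP; exists y.
    rewrite /nonedge !inE xS cx yS (negPf cy) exy /=.
    move: (xL); rewrite inE xS /= => -> /=.
    by apply: contraNT exy => yL; apply: full; rewrite // inE yS.
  have [|||ham|[E dl]] :=
      @ham_path_or_low_set _ c e m t S LX u v be mX mY LXS uS cu vS cv fo.
  - by move=> x xL; apply: deg; apply: LS; move: xL; rewrite inE => /andP[].
  - by apply: leq_trans LXY; apply: leq_addr.
  - by move: tm; clear; lia.
  - exact: Or31.
  - by apply: Or32; exists true, LX.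
have [/existsP[x' /existsP[y' /and3P[nxy' xL' yL']]]|noYX] := boolP
    [exists x, exists y, [&& nonedge c e S x y, x \in L & y \notin L]]; last first.
  have LYS : LY \subset side c S false.
    by apply/subsetP => z; rewrite !inE => /andP[/andP[-> _] ->].
  have fo : full_outside (predC c) e S LY.
    move=> z w zS /= cz zL wS; rewrite negbK => cw.
    have {}zL : z \notin L by apply: contra zL => zL; rewrite inE zL (negPf cz).
    rewrite es; apply: contraNT noYX => exy.
    apply/existsP; exists w; apply/existsP; exists z.
    rewrite /nonedge !inE zS cw wS (negPf cz) exy /=.
    move: (zL); rewrite inE zS /= => -> /=; rewrite andbT.
    by apply: contraNT exy => wL; apply: full; rewrite // inE wS.
  have [|||||||||||ham|[E dl]] :=
      @ham_path_or_low_set _ (predC c) e m t S LY v u (bipartite_predC be).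
  - by rewrite side_predC.
  - by rewrite side_predC.
  - by rewrite side_predC.
  - by [].
  - by [].
  - by [].
  - by rewrite /= negbK.
  - exact: fo.
  - by move=> z zL; apply: deg; apply: LS; move: zL; rewrite inE => /andP[].
  - by apply: leq_trans LXY; apply: leq_addl.
  - by move: tm; clear; lia.
  - by apply: Or31; apply: ham_path_sym.
  - by apply: Or32; exists false, LY.
have := nxy; rewrite /nonedge !inE => /and3P[/andP[xS /eqP cx] /andP[yS /eqP cy] exy].
have := nxy'; rewrite /nonedge !inE => /and3P[/andP[xS' /eqP cx'] /andP[yS' /eqP cy'] exy'].
have dX := degX _ xS cx xL.
have dY : m <= #|nbr e S y'| + #|LX| by apply: degY; rewrite // cy'.
have yLY : y \in LY by rewrite inE yL cy.
have xLX : x' \in LX by rewrite inE xL' cx'.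
have E1 := closed _ _ nxy; have E2 := closed _ _ nxy'.
have D1 := deg _ yS; have D2 := deg _ xS'.
have LX0 : 0 < #|LX| by apply/card_gt0P; exists x'.
have LY0 : 0 < #|LY| by apply/card_gt0P; exists y.
(* Now [x] has degree at least [m - #|LY|] and [y] at least [t], so closedness gives
   [t <= #|LY| + 1], and likewise [t <= #|LX| + 1]. Both sets are nonempty with total size at most
   [t], which leaves a single possibility. *)
have [cX cY t2] : [/\ #|LX| = 1, #|LY| = 1 & t = 2].
  by move: LX0 LY0 LXY dX dY E1 E2 D1 D2; clear; split; lia.
have LXE z : z \in S -> c z -> z != x' -> z \notin L.
  move=> zS cz; apply: contra => zL.
  have /cards1P[w Ew] : #|LX| == 1 by rewrite cX.
  have : z \in LX by rewrite inE zL cz.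
  by move: xLX; rewrite Ew !inE => /eqP-> /eqP->.
have LYE z : z \in S -> ~~ c z -> z != y -> z \notin L.
  move=> zS cz; apply: contra => zL.
  have /cards1P[w Ew] : #|LY| == 1 by rewrite cY.
  have : z \in LY by rewrite inE zL (negPf cz).
  by move: yLY; rewrite Ew !inE => /eqP-> /eqP->.
have d1 : #|nbr e S x'| = 2 by move: E2 dY D2; rewrite cX t2; clear; lia.
have d2 : #|nbr e S y| = 2 by move: E1 dX D1; rewrite cY t2; clear; lia.
have [eab|eab] := boolP (e x' y).
  apply: Or33; split=> //; exists x', y; rewrite !inE xS' cx' yS cy; split=> //.
    by rewrite setUC (setUidPl _) ?d1 // sub1set inE yS.
  by rewrite setUC (setUidPl _) ?d2 // sub1set inE xS' es.
have fullxy z w : z \in S -> c z -> z != x' -> w \in S -> ~~ c w -> w != y -> e z w.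
  by move=> zS cz zx wS cw wy; apply: full => //; [apply: LXE | apply: LYE].
apply: Or31.
have cyN : ~~ c y by rewrite cy.
have m3 : 3 < m by exact: ltnW.
have [Ex|ux] := eqVneq u x'.
  by rewrite Ex; apply: (@ham_path_two_low_start _ c e m S x' y); rewrite ?d1 ?d2.
have [Ey|vy] := eqVneq v y; last first.
  by apply: (@ham_path_two_low_inner _ c e m S x' y); rewrite ?d1 ?d2.
rewrite Ey; apply: ham_path_sym => //.
apply: (@ham_path_two_low_start _ (predC c) e m S y x') => //=; rewrite ?d1 ?d2 ?negbK //.
- exact: bipartite_predC.
- by rewrite side_predC.
- by rewrite side_predC.
- move=> z w zS cz zy wS; rewrite negbK => cw wx; rewrite es; exact: fullxy.
- by rewrite es.
Qed.

End Dichotomy.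

(** * Inequalities for subeigenvectors *)

Import Order.TTheory GRing.Theory Num.Theory.

Section Subeigenvector.
Local Open Scope ring_scope.
Variables (R : realFieldType) (n : nat).
Implicit Types (b : rel 'I_n) (f g : 'I_n -> R) (q : R) (x y : 'I_n).

Definition row_deg b x := #|[set y | b x y]|.
Definition transpose b : rel 'I_n := fun y x => b x y.

(* [f] and [g] are the restrictions to the two sides of a nonzero nonnegative
   vector [z] with [Q z >= q z]; the modulus of any eigenvector is one. *)
Definition subeigen q b f g :=
  [/\ forall x, 0 <= f x, forall y, 0 <= g y,
      forall x, q * f x <= (row_deg b x)%:R * f x + \sum_y (b x y)%:R * g y,
      forall y, q * g y <= (row_deg (transpose b) y)%:R * g y + \sum_x (b x y)%:R * f x &
      (exists x, f x != 0) \/ (exists y, g y != 0)].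

Lemma subeigen_transpose q b f g : subeigen q b f g -> subeigen q (transpose b) g f.
Proof.
move=> [f0 g0 hf hg nz]; split=> //; last by case: nz; [right | left].
Qed.

Lemma row_degE b x : (row_deg b x)%:R = \sum_y (b x y)%:R :> R.
Proof.
rewrite /row_deg -sum1_card natr_sum big_mkcond /=; apply: eq_bigr => y _.
by rewrite inE; case: (b x y).
Qed.

Lemma row_deg_le b x : (row_deg b x <= n)%N.
Proof. by rewrite -[X in (_ <= X)%N]card_ord max_card. Qed.

Lemma row_deg_full b x y : (n <= row_deg b x)%N -> b x y.
Proof.
move=> nd; have : [set y | b x y] == [set: 'I_n].
  by rewrite eqEcard subsetT cardsT card_ord.
by move/eqP/setP/(_ y); rewrite !inE.
Qed.

Lemma row_sum_le b x g (A : R) : (forall y, g y <= A) ->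
  \sum_y (b x y)%:R * g y <= (row_deg b x)%:R * A.
Proof.
move=> gA; rewrite row_degE mulr_suml; apply: ler_sum => y _.
by apply: ler_wpM2l.
Qed.

Lemma row_sum_le_sum b x g : (forall y, 0 <= g y) ->
  \sum_y (b x y)%:R * g y <= \sum_y g y.
Proof.
move=> g0; apply: ler_sum => y _; case: (b x y); rewrite ?mul1r // mul0r.
exact: g0.
Qed.

Lemma subeigen_le_sum q b f g x : subeigen q b f g -> (q - n%:R) * f x <= \sum_y g y.
Proof.
move=> [f0 g0 hf _ _].
have := hf x; have := row_sum_le_sum b x g0.
have : (row_deg b x)%:R * f x <= n%:R * f x.
  by apply: ler_wpM2r; rewrite // ler_nat row_deg_le.
by lra.
Qed.

Lemma subeigen_sum_gt0 q b f g : n%:R < q -> subeigen q b f g -> 0 < \sum_y g y.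
Proof.
move=> nq hs; have [f0 g0 hf hg nz] := hs.
rewrite lt_def sumr_ge0 // andbT; apply/negP => /eqP Y0.
have fz x : f x = 0.
  have := subeigen_le_sum x hs; rewrite Y0 pmulr_rle0 ?subr_gt0 // => fx.
  by apply/eqP; rewrite eq_le fx f0.
have gz y : g y = 0.
  exact: (psumr_eq0P (P := predT) (fun y _ => g0 y) Y0).
by case: nz => -[x]; rewrite ?fz ?gz eqxx.
Qed.

(** Symmetry moves [Q] onto the degree vector, where it multiplies the entry [d] by [d + S / d],
    with [S] the sum of the degrees of the neighbours. Since [S <= d * n] and [S <= e], this factor
    is at most [n + e / n]. Positive degrees make the pairing [D] positive, so it can be
    cancelled. *)
Lemma subeigen_edges q b f g : subeigen q b f g ->
  (forall x, 0 < row_deg b x)%N -> (forall y, 0 < row_deg (transpose b) y)%N ->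
  n%:R * q <= n%:R ^+ 2 + (\sum_x row_deg b x)%:R.
Proof.
move=> [f0 g0 hf hg nz] d1 d2.
pose dx x : R := (row_deg b x)%:R; pose dy y : R := (row_deg (transpose b) y)%:R.
set e : R := (\sum_x _)%:R.
have eX : e = \sum_x dx x by rewrite /e natr_sum.
have eY : e = \sum_y dy y.
  rewrite eX /dx /dy; under eq_bigr => x _ do rewrite row_degE.
  by rewrite exchange_big; apply: eq_bigr => y _; rewrite row_degE.
have arith (d S : R) : 0 <= d -> d <= n%:R -> S <= d * n%:R -> S <= e ->
    n%:R * (d ^+ 2 + S) <= (n%:R ^+ 2 + e) * d.
  move=> d0 dn S1 S2; have [le|lt] := lerP (d * n%:R) e.
    have : n%:R * S <= n%:R * (d * n%:R) by apply: ler_wpM2l.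
    have : d * (d * n%:R) <= d * e by apply: ler_wpM2l.
    by lra.
  have : n%:R * S <= n%:R * e by apply: ler_wpM2l.
  have : 0 <= (n%:R - d) * (d * n%:R - e) by apply: mulr_ge0; rewrite subr_ge0 // ltW.
  by lra.
have hX x : n%:R * (dx x ^+ 2 + \sum_y (b x y)%:R * dy y) <= (n%:R ^+ 2 + e) * dx x.
  apply: arith; rewrite ?ler0n // /dx ?ler_nat ?row_deg_le //.
    by apply: row_sum_le => y; rewrite ler_nat row_deg_le.
  by rewrite eY; apply: row_sum_le_sum => y; apply: ler0n.
have hY y : n%:R * (dy y ^+ 2 + \sum_x (b x y)%:R * dx x) <= (n%:R ^+ 2 + e) * dy y.
  apply: arith; rewrite ?ler0n // /dy ?ler_nat ?row_deg_le //.
    by apply: (@row_sum_le (transpose b)) => x; rewrite ler_nat row_deg_le.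
  by rewrite eX; apply: (@row_sum_le_sum (transpose b)) => x; apply: ler0n.
set D := \sum_x f x * dx x + \sum_y g y * dy y.
have D0 : 0 < D.
  have p1 x : 0 <= f x * dx x by rewrite mulr_ge0 ?ler0n.
  have p2 y : 0 <= g y * dy y by rewrite mulr_ge0 ?ler0n.
  rewrite lt_def addr_ge0 ?sumr_ge0 // andbT paddr_eq0 ?sumr_ge0 //.
  apply/negP => /andP[/eqP z1 /eqP z2]; case: nz => -[x /eqP]; apply.
    have /eqP : f x * dx x = 0 by apply: (psumr_eq0P (P := predT) (fun x _ => p1 x) z1).
    by rewrite mulf_eq0 pnatr_eq0 eqn0Ngt d1 orbF => /eqP.
  have /eqP : g x * dy x = 0 by apply: (psumr_eq0P (P := predT) (fun x _ => p2 x) z2).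
  by rewrite mulf_eq0 pnatr_eq0 eqn0Ngt d2 orbF => /eqP.
rewrite -(ler_pM2r D0).
have step1 : q * D <= \sum_x f x * (dx x ^+ 2 + \sum_y (b x y)%:R * dy y) +
                      \sum_y g y * (dy y ^+ 2 + \sum_x (b x y)%:R * dx x).
  have -> : \sum_x f x * (dx x ^+ 2 + \sum_y (b x y)%:R * dy y) +
            \sum_y g y * (dy y ^+ 2 + \sum_x (b x y)%:R * dx x) =
    \sum_x dx x * (dx x * f x + \sum_y (b x y)%:R * g y) +
    \sum_y dy y * (dy y * g y + \sum_x (b x y)%:R * f x).
    have expand (u a w : 'I_n -> R) (B : 'I_n -> 'I_n -> R) :
        \sum_x u x * (a x + \sum_y B x y * w y) =
        \sum_x u x * a x + \sum_x \sum_y u x * (B x y * w y).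
      by rewrite -big_split; apply: eq_bigr => x _; rewrite mulrDr mulr_sumr.
    rewrite (expand f (fun x => dx x ^+ 2) dy (fun x y => (b x y)%:R)).
    rewrite (expand g (fun x => dy x ^+ 2) dx (fun y x => (b x y)%:R)).
    rewrite (expand dx (fun x => dx x * f x) g (fun x y => (b x y)%:R)).
    rewrite (expand dy (fun x => dy x * g x) f (fun y x => (b x y)%:R)).
    rewrite addrACA [RHS]addrACA; congr (_ + _).
      by congr (_ + _); apply: eq_bigr => x _; ring.
    rewrite addrC [X in X + _]exchange_big [X in _ + X]exchange_big /=.
    by congr (_ + _); apply: eq_bigr => x _; apply: eq_bigr => y _; ring.
  rewrite mulrDr !mulr_sumr; apply: lerD; apply: ler_sum => x _.
    have := ler_wpM2l (ler0n R (row_deg b x)) (hf x).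
    by rewrite -/(dx x); apply: le_trans; rewrite le_eqVlt; apply/orP; left; apply/eqP; ring.
  have := ler_wpM2l (ler0n R (row_deg (transpose b) x)) (hg x).
  by rewrite -/(dy x); apply: le_trans; rewrite le_eqVlt; apply/orP; left; apply/eqP; ring.
have := ler_wpM2l (ler0n R n) step1; rewrite mulrA => /le_trans; apply.
rewrite mulrDr [_ * D]mulrDr !mulr_sumr.
apply: lerD; apply: ler_sum => x _.
  by have := ler_wpM2l (f0 x) (hX x); lra.
by have := ler_wpM2l (g0 x) (hY x); lra.
Qed.

(* All the estimates lose nothing exactly for the extremal graph, so that
   [eps * (q - k) >= t * k] forces equality in each of them. *)
Lemma subeigen_low_set q b f g (L : {set 'I_n}) (k : nat) :
  subeigen q b f g -> (0 < #|L|)%N -> (#|L| <= k)%N -> (k < n)%N ->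
  (forall x, x \in L -> row_deg b x <= k)%N ->
  0 < q - 2 * n%:R + #|L|%:R ->
  #|L|%:R * k%:R <= (q - 2 * n%:R + #|L|%:R) * (q - k%:R) ->
  exists2 B : {set 'I_n}, #|B| = k & forall x y, b x y = (x \notin L) || (y \in B).
Proof.
move=> hs L0 Lk kn degL eps0 epsk; have [f0 g0 hf hg nz] := hs.
set t : R := #|L|%:R in eps0 epsk *.
pose N : R := n%:R; pose K : R := k%:R.
rewrite -/N -/K in eps0 epsk.
have t0 : 0 < t by rewrite ltr0n.
have tK : t <= K by rewrite ler_nat.
have KN : K < N by rewrite ltr_nat.
have qN : N < q by lra.
have qK : K < q by lra.
set Y := \sum_y g y.
have Y0 : 0 < Y := subeigen_sum_gt0 qN hs.
pose P := \sum_(x | x \notin L) f x; pose s := \sum_(x in L) f x.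
have PsE : \sum_x f x = P + s by rewrite (bigID (mem L)) /= addrC.
(* The uniform upper bound on [g] that [subeigen_le_sum] provides. *)
pose A := (P + s) / (q - N).
have qN0 : 0 < q - N by rewrite subr_gt0.
have AE : (q - N) * A = P + s by rewrite /A mulrC divfK // gt_eqF.
have A0 : 0 < A.
  by rewrite divr_gt0 // -PsE; apply: subeigen_sum_gt0 (subeigen_transpose hs).
have gA y : g y <= A.
  rewrite -(ler_pM2l qN0) AE -PsE.
  exact: (subeigen_le_sum y (subeigen_transpose hs)).
have fY x : (q - N) * f x <= Y := subeigen_le_sum x hs.
have fL x : x \in L -> (q - K) * f x <= K * A.
  move=> xL; have := hf x; have := row_sum_le b x gA.
  have dK : (row_deg b x)%:R <= K by rewrite ler_nat degL.
  have := ler_wpM2r (f0 x) dK; have := ler_wpM2r (ltW A0) dK.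
  by lra.
have cardL : \sum_(x in L) (1 : R) = t by rewrite sumr_const.
have cardLC : \sum_(x | x \notin L) (1 : R) = N - t.
  have : \sum_(x < n) (1 : R) = N by rewrite sumr_const card_ord.
  by rewrite (bigID (mem L)) /= cardL => <-; rewrite addrAC subrr add0r.
(* Total slacks: [al] of [(q - N) * f x <= Y] outside [L], [be] of [(q - K) * f x <= K * A] on [L],
   and [ga] of the sum of the inequalities over the second side. *)
pose al := (N - t) * Y - (q - N) * P.
pose be := t * K * A - (q - K) * s.
pose ga := N * P + K * s + t * K * A - (q - N + t) * Y.
have alE : al = \sum_(x | x \notin L) (Y - (q - N) * f x).
  rewrite sumrB -mulr_sumr -/P /al -cardLC mulr_suml; congr (_ - _).
  by apply: eq_bigr => x _; rewrite mul1r.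
have beE : be = \sum_(x in L) (K * A - (q - K) * f x).
  rewrite sumrB -[X in _ = _ - X]mulr_sumr -/s /be -cardL -mulrA mulr_suml; congr (_ - _).
  by apply: eq_bigr => x _; rewrite mul1r.
have al0 : 0 <= al by rewrite alE sumr_ge0 // => x _; rewrite subr_ge0.
have be0 : 0 <= be by rewrite beE sumr_ge0 // => x xL; rewrite subr_ge0 fL.
have ga0 : 0 <= ga.
  rewrite subr_ge0.
  have h1 : q * Y <= \sum_y ((row_deg (transpose b) y)%:R * g y + \sum_x (b x y)%:R * f x).
    by rewrite mulr_sumr; apply: ler_sum => y _; apply: hg.
  (* An edge [x y] contributes [f x + g y] to either sum. This moves the estimate to the side of
     [L], where the degrees are controlled. *)
  have h2 : \sum_y ((row_deg (transpose b) y)%:R * g y + \sum_x (b x y)%:R * f x) =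
            \sum_x ((row_deg b x)%:R * f x + \sum_y (b x y)%:R * g y).
    rewrite !big_split /= addrC; congr (_ + _).
      by rewrite exchange_big; apply: eq_bigr => x _; rewrite row_degE mulr_suml.
    rewrite [RHS]exchange_big; apply: eq_bigr => y _.
    by rewrite row_degE mulr_suml.
  have h3 : \sum_x ((row_deg b x)%:R * f x + \sum_y (b x y)%:R * g y) <=
            (K * s + t * (K * A)) + (N * P + (N - t) * Y).
    rewrite (bigID (mem L)) /=; apply: lerD.
      rewrite -cardL mulr_suml mulr_sumr -big_split /=; apply: ler_sum => x xL.
      rewrite mul1r; have dK : (row_deg b x)%:R <= K by rewrite ler_nat degL.
      apply: lerD; first exact: ler_wpM2r.
      apply: le_trans (row_sum_le b x gA) _; exact: (ler_wpM2r (ltW A0)).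
    rewrite -cardLC mulr_suml mulr_sumr -big_split /=; apply: ler_sum => x xL.
    rewrite mul1r; apply: lerD; last exact: row_sum_le_sum.
    by apply: ler_wpM2r => //; rewrite ler_nat row_deg_le.
  by move: h1; rewrite h2 => /le_trans /(_ h3); lra.
set eps := q - 2 * N + t in eps0 epsk.
(* The multipliers are chosen so that [Y] and [s] cancel after [P] is eliminated. They are positive,
   and the bracket on the right is nonpositive because [eps * (q - K) >= t * K]; so every term on
   the left vanishes. *)
have key : (q - K) * ((q - N + t) * al + (N - t) * ga) + ((N - t) * K + q * eps) * be =
    A * q * (t * K * (N - t) + eps * (t * K - (q - K) * (q - N))).
  have PE : P = (q - N) * A - s by rewrite AE addrK.
  by rewrite /al /be /ga /eps PE; ring.
have br : t * K * (N - t) + eps * (t * K - (q - K) * (q - N)) <= 0.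
  have := ler_wpM2r (ltW qN0) epsk; have -> : q - N = eps + N - t by rewrite /eps; ring.
  by lra.
have Nt : 0 < N - t by lra.
have k1 : 0 <= (q - K) * ((q - N + t) * al).
  by do 2 (apply: mulr_ge0; first by lra).
have k2 : 0 <= (q - K) * ((N - t) * ga).
  by do 2 (apply: mulr_ge0; first by lra).
have c3 : 0 < (N - t) * K + q * eps.
  by rewrite ltr_wpDl ?mulr_ge0 ?ltW ?mulr_gt0 //; lra.
have k3 : 0 <= ((N - t) * K + q * eps) * be by rewrite mulr_ge0 // ltW.
have Aq : 0 <= A * q by rewrite mulr_ge0 ?ltW //; lra.
have tot : A * q * (t * K * (N - t) + eps * (t * K - (q - K) * (q - N))) <= 0.
  by rewrite mulr_ge0_le0.
rewrite -key mulrDr in tot.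
have alz : al = 0.
  have : (q - K) * ((q - N + t) * al) = 0 by lra.
  move/eqP; rewrite !mulf_eq0 => /or3P[/eqP|/eqP|/eqP//]; lra.
have bez : be = 0.
  have : ((N - t) * K + q * eps) * be = 0 by lra.
  by move/eqP; rewrite mulf_eq0 gt_eqF //= => /eqP.
have fYe x : x \notin L -> (q - N) * f x = Y.
  move=> xL; move: alz; rewrite alE => /psumr_eq0P -/(_ _ _ xL) H.
  by apply/eqP; rewrite eq_sym -subr_eq0 H // => z _; rewrite subr_ge0.
have fLe x : x \in L -> (q - K) * f x = K * A.
  move=> xL; move: bez; rewrite beE => /psumr_eq0P -/(_ _ _ xL) H.
  by apply/eqP; rewrite eq_sym -subr_eq0 H // => z zL; rewrite subr_ge0 fL.
have fullX x y : x \notin L -> b x y.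
  move=> xL; apply: row_deg_full; rewrite -(ler_nat R) -/N.
  have fx : 0 < f x by rewrite -(pmulr_rgt0 _ qN0) fYe.
  rewrite -(ler_pM2r fx); have := hf x; have := row_sum_le_sum b x g0; have := fYe _ xL.
  by rewrite -/Y; lra.
have degLe x : x \in L -> row_deg b x = k /\ forall y, b x y -> g y = A.
  move=> xL; have dK : (row_deg b x)%:R <= K by rewrite ler_nat degL.
  have h1 := hf x; have h2 := row_sum_le b x gA; have h3 := fLe _ xL.
  have h4 := ler_wpM2r (f0 x) dK; have h5 := ler_wpM2r (ltW A0) dK.
  have h6 : (row_deg b x)%:R * A = K * A by lra.
  have h7 : \sum_y (b x y)%:R * g y = (row_deg b x)%:R * A by lra.
  split; first by apply/eqP; rewrite -(eqr_nat R) -(inj_eq (mulIf (negbT (gt_eqF A0)))) h6.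
  move=> y bxy; have : \sum_y ((b x y)%:R * A - (b x y)%:R * g y) = 0.
    by rewrite sumrB h7 row_degE mulr_suml subrr.
  move=> /psumr_eq0P -/(_ _ y isT) H; have := H _; rewrite bxy !mul1r => Hz.
  apply/eqP; rewrite eq_sym -subr_eq0 Hz // => z _; rewrite -mulrBr mulr_ge0 //.
  by rewrite subr_ge0.
(* A vertex [y] with [g y = A] satisfies [(q - N) * g y = P + s], which forces it to be adjacent to
   every vertex. Hence all vertices of [L] have the same neighbours. *)
have common x y : x \in L -> b x y -> forall x', b x' y.
  move=> xL bxy x'; have gy := (degLe _ xL).2 _ bxy.
  apply: (@row_deg_full (transpose b)); rewrite -(ler_nat R) -/N.
  rewrite -(ler_pM2r A0); have := hg y; have := row_sum_le_sum (transpose b) y f0.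
  by rewrite gy PsE -AE /transpose; lra.
have /card_gt0P [x0 x0L] := L0.
exists [set y | b x0 y]; first exact: (degLe _ x0L).1.
move=> x y; rewrite inE; have [xL|xL] := boolP (x \in L); last by rewrite fullX.
by apply/idP/idP => /common; apply.
Qed.

(** [AX] and [AY] bound all entries of [f] and [g]. The first estimate is the inequality at [r],
    with [r s] counted as an edge; the second sums the inequalities over the other [x], among which
    at most [k] are adjacent to [s]. The transposed graph supplies the remaining two. *)
Lemma subeigen_pair_bound q b f g (r s : 'I_n) (k : nat) :
  subeigen q b f g -> n%:R < q ->
  (#|[set y | b r y && (y != s)]| <= k)%N -> (#|[set x | b x s && (x != r)]| <= k)%N ->
  let P := \sum_(x | x != r) f x in let Y := \sum_(y | y != s) g y in
  let AX := (Y + g s) / (q - n%:R) in let AY := (P + f r) / (q - n%:R) in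
  (q - k%:R - 1) * f r <= g s + k%:R * AY /\
  q * P <= (n%:R - 1) * P + k%:R * AX + (n%:R - 1) * Y + k%:R * g s.
Proof.
move=> hs nq dr ds P Y AX AY; have [f0 g0 hf hg nz] := hs.
have qn0 : 0 < q - n%:R by rewrite subr_gt0.
have PE : \sum_x f x = P + f r by rewrite (bigD1 r) //= addrC.
have YE : \sum_y g y = Y + g s by rewrite (bigD1 s) //= addrC.
have fA x : f x <= AX.
  by rewrite ler_pdivlMr // mulrC -YE; apply: subeigen_le_sum hs.
have gA y : g y <= AY.
  by rewrite ler_pdivlMr // mulrC -PE; apply: subeigen_le_sum (subeigen_transpose hs).
have AX0 : 0 <= AX := le_trans (f0 r) (fA r).
have AY0 : 0 <= AY := le_trans (g0 s) (gA s).
have cr : \sum_(y | y != s) (b r y)%:R <= k%:R :> R.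
  rewrite -(ler_nat R) in dr; apply: le_trans dr.
  rewrite -sum1_card natr_sum big_mkcond [X in _ <= X]big_mkcond /=.
  by apply: ler_sum => y _; rewrite inE; case: (b r y); case: (y != s).
have cs : \sum_(x | x != r) (b x s)%:R <= k%:R :> R.
  rewrite -(ler_nat R) in ds; apply: le_trans ds.
  rewrite -sum1_card natr_sum big_mkcond [X in _ <= X]big_mkcond /=.
  by apply: ler_sum => x _; rewrite inE; case: (b x s); case: (x != r).
have cn (z : 'I_n) : \sum_(x | x != z) (1 : R) = n%:R - 1.
  have : \sum_(x < n) (1 : R) = n%:R by rewrite sumr_const card_ord.
  by rewrite (bigD1 z) //= => <-; rewrite addrC addrK.
have b1 x y : (b x y)%:R <= 1 :> R by rewrite -[1]/(1%:R) ler_nat leq_b1.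
have e1 x : \sum_y (b x y)%:R = (b x s)%:R + \sum_(y | y != s) (b x y)%:R :> R.
  by rewrite (bigD1 s).
have e2 x : \sum_y (b x y)%:R * g y =
            (b x s)%:R * g s + \sum_(y | y != s) (b x y)%:R * g y.
  by rewrite (bigD1 s).
split.
  have := hf r; rewrite row_degE e1 e2.
  have h1 : \sum_(y | y != s) (b r y)%:R * g y <= k%:R * AY.
    apply: le_trans (ler_wpM2r AY0 cr); rewrite mulr_suml; apply: ler_sum => y _.
    exact: ler_wpM2l.
  have := ler_wpM2r (f0 r) (b1 r s); have := ler_wpM2r (g0 s) (b1 r s).
  have := ler_wpM2r (f0 r) cr.
  by lra.
have h1 : q * P <= \sum_(x | x != r) ((row_deg b x)%:R * f x + \sum_y (b x y)%:R * g y).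
  by rewrite mulr_sumr; apply: ler_sum => x _; apply: hf.
apply: (le_trans h1).
have h2 x : (row_deg b x)%:R * f x + \sum_y (b x y)%:R * g y <=
    (n%:R - 1) * f x + (b x s)%:R * AX + Y + (b x s)%:R * g s.
  rewrite row_degE e1 e2.
  have d1 : \sum_(y | y != s) (b x y)%:R <= n%:R - 1 :> R.
    by rewrite -(cn s); apply: ler_sum.
  have d2 : \sum_(y | y != s) (b x y)%:R * g y <= Y.
    by apply: ler_sum => y _; have := ler_wpM2r (g0 y) (b1 x y); rewrite mul1r.
  have := ler_wpM2r (f0 x) d1; have := ler_wpM2l (ler0n R (b x s)) (fA x).
  by lra.
apply: le_trans (ler_sum _ (fun x _ => h2 x)) _.
rewrite !big_split /= -mulr_sumr -!mulr_suml -/P.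
have -> : \sum_(x | x != r) Y = (n%:R - 1) * Y.
  by rewrite -(cn r) mulr_suml; apply: eq_bigr => x _; rewrite mul1r.
have := ler_wpM2r AX0 cs; have := ler_wpM2r (g0 s) cs.
by lra.
Qed.

(** Write [eps = q - 2n + 2]. Adding the estimates for the two sides and eliminating [f r + g s]
    gives [eps * (q - k - 2) <= 2 * k]. The hypothesis reads [eps * (q - k - 1) >= 2 * k + 2], so
    [eps >= 2] and then [q <= 2 * k + 2], against [q > 2n - 2 >= 2 * k + 2]. *)
Lemma subeigen_low_pair q b f g (r s : 'I_n) (k : nat) :
  subeigen q b f g -> (k.+1 < n)%N ->
  (#|[set y | b r y && (y != s)]| <= k)%N -> (#|[set x | b x s && (x != r)]| <= k)%N ->
  0 < q - 2 * n%:R + 2 ->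
  2 * (k%:R + 1) <= (q - 2 * n%:R + 2) * (q - (k%:R + 1)) -> False.
Proof.
move=> hs kn dr ds eps0 epsk.
have [f0 g0 _ _ nz] := hs.
set N : R := n%:R; set K : R := k%:R; rewrite -/N -/K in eps0 epsk.
have K0 : 0 <= K by apply: ler0n.
have KN : K + 2 <= N by rewrite /K /N -[2]/(2%:R) -natrD ler_nat; lia.
have qN : N < q by lra.
have [A1 A2] := subeigen_pair_bound hs qN dr ds.
have [B1 B2] := subeigen_pair_bound (subeigen_transpose hs) qN ds dr.
move: A1 A2 B1 B2; rewrite /transpose -/N -/K.
set P := \sum_(x | x != r) f x; set Y := \sum_(y | y != s) g y.
set AX := (Y + g s) / _; set AY := (P + f r) / _ => A1 A2 B1 B2.
have qN0 : 0 < q - N by rewrite subr_gt0.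
have Y0 : 0 < Y + g s.
  by have := subeigen_sum_gt0 qN hs; rewrite (bigD1 s) //= addrC.
have P0 : 0 < P + f r.
  by have := subeigen_sum_gt0 qN (subeigen_transpose hs); rewrite (bigD1 r) //= addrC.
have AXE : (q - N) * AX = Y + g s by rewrite mulrC divfK // gt_eqF.
have AYE : (q - N) * AY = P + f r by rewrite mulrC divfK // gt_eqF.
have A0 : 0 < AX + AY by rewrite addr_gt0 // divr_gt0.
set A := AX + AY in A0; set c := f r + g s.
have AE : (q - N) * A = P + Y + c by rewrite /A mulrDr AXE AYE /c; ring.
set eps := q - 2 * N + 2 in eps0 epsk.
have C1 : (q - K - 2) * c <= K * A by rewrite /c /A; lra.
have C2 : eps * (P + Y) <= K * (A + c) by rewrite /eps /A /c; lra.
have C3 : (eps * (q - N) - K) * A <= (K + eps) * c.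
  have -> : (eps * (q - N) - K) * A = eps * ((q - N) * A) - K * A by ring.
  by rewrite AE; lra.
have q2 : 0 < q - K - 2 by lra.
have C4 : (eps * (q - N) - K) * (q - K - 2) * A <= (K + eps) * K * A.
  have := ler_wpM2l (ltW q2) C3.
  have Ke : 0 <= K + eps by lra.
  have := ler_wpM2l Ke C1.
  by lra.
rewrite ler_pM2r // in C4.
have C5 : (q - N) * (eps * (q - K - 2)) <= (q - N) * (2 * K).
  by move: C4; rewrite /eps; lra.
rewrite ler_pM2l // in C5.
have e2 : 2 <= eps by lra.
have : 2 * (q - K - 2) <= eps * (q - K - 2) by rewrite ler_pM2r.
have : 2 * N - 2 < q by move: eps0; rewrite /eps; lra.
by lra.
Qed.

End Subeigenvector.

(** * Graphs given by a biadjacency relation *)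

Section Adjacency.
Variables (n : nat) (b : rel 'I_n).
Implicit Types (x y : 'I_n).

Lemma split_lshift x : split (lshift n x) = inl x.
Proof. exact: (unsplitK (inl x)). Qed.

Lemma split_rshift y : split (rshift n y) = inr y.
Proof. exact: (unsplitK (inr y)). Qed.

Lemma adj_lr x y : adj b (lshift n x) (rshift n y) = b x y.
Proof. by rewrite /adj split_lshift split_rshift. Qed.

Lemma adj_rl x y : adj b (rshift n y) (lshift n x) = b x y.
Proof. by rewrite /adj split_lshift split_rshift. Qed.

Lemma adj_ll x y : adj b (lshift n x) (lshift n y) = false.
Proof. by rewrite /adj !split_lshift. Qed.

Lemma adj_rr x y : adj b (rshift n x) (rshift n y) = false.
Proof. by rewrite /adj !split_rshift. Qed.

Lemma inX_l x : inX (lshift n x).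
Proof. by rewrite /inX split_lshift. Qed.

Lemma inX_r y : inX (rshift n y) = false.
Proof. by rewrite /inX split_rshift. Qed.

Lemma adj_bipartite : bipartite (@inX n) (adj b).
Proof.
split=> [i j|i j]; rewrite /adj /inX; case: (split i) => a; case: (split j) => //.
Qed.

Lemma shiftP (i : 'I_(n + n)) : (exists x, i = lshift n x) \/ (exists y, i = rshift n y).
Proof.
by case: (split_ordP i) => x ->; [left | right]; exists x.
Qed.

Lemma card_shift (A : {pred 'I_(n + n)}) :
  #|A| = #|[set x | lshift n x \in A]| + #|[set y | rshift n y \in A]|.
Proof.
rewrite -!sum1_card big_split_ord /=.
by congr (_ + _); apply: eq_bigl => x; rewrite inE.
Qed.

Lemma deg_l x : deg b (lshift n x) = row_deg b x.
Proof.
rewrite /deg card_shift /= (eq_card0 (A := [set _ | _])) ?add0n.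
  by apply: eq_card => y; rewrite !inE adj_lr.
by move=> y; rewrite !inE adj_ll.
Qed.

Lemma deg_r y : deg b (rshift n y) = row_deg (transpose b) y.
Proof.
rewrite /deg card_shift /= [X in _ + X](eq_card0 (A := [set _ | _])) ?addn0.
  by apply: eq_card => x; rewrite !inE adj_rl.
by move=> x; rewrite !inE adj_rr.
Qed.

Lemma card_sideT a : #|side (@inX n) [set: 'I_(n + n)] a| = n.
Proof.
rewrite card_shift; case: a.
  rewrite [X in _ + X](eq_card0 (A := [set _ | _])) ?addn0; last first.
    by move=> y; rewrite !inE ?inX_r.
  rewrite -[RHS]card_ord -cardsT; apply: eq_card => x.
  by rewrite !inE ?inX_l.
rewrite (eq_card0 (A := [set _ | _])) ?add0n; last first.
  by move=> y; rewrite !inE ?inX_l.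
rewrite -[RHS]card_ord -cardsT; apply: eq_card => x.
by rewrite !inE ?inX_r.
Qed.

End Adjacency.

(** * Recognition of the extremal graph *)

Lemma exists_perm_mem (T : finType) (A B : {set T}) : #|A| = #|B| ->
  exists s : {perm T}, forall x, (s x \in B) = (x \in A).
Proof.
(* Each set is listed before its complement; matching positions in the two lists then carries [A]
   onto [B]. *)
move=> AB; pose l (C : {set T}) := enum C ++ enum (~: C).
have lu C : uniq (l C).
  rewrite cat_uniq !enum_uniq /= andbT; apply/hasPn => x.
  by rewrite !mem_enum inE.
have lm C x : x \in l C by rewrite mem_cat !mem_enum inE orbN.
have ls C : size (l C) = #|T| by rewrite -(card_uniqP (lu C)); apply: eq_card => x; rewrite lm.
pose h x := nth x (l B) (index x (l A)).
have hi x : index x (l A) < size (l B) by rewrite ls -(ls A) index_mem.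
have h_inj : injective h.
  move=> x y /eqP; rewrite /h (set_nth_default x y (hi y)) nth_uniq //.
  by move=> /eqP E; rewrite -(nth_index x (lm A x)) E nth_index.
exists (perm h_inj) => x; rewrite permE /h nth_cat -cardE -AB.
have -> : (index x (l A) < #|A|) = (x \in A).
  rewrite index_cat mem_enum; case xA: (x \in A).
    by rewrite cardE index_mem mem_enum.
  by rewrite cardE ltnNge leq_addr.
case xA: (x \in A).
  rewrite -mem_enum mem_nth // -cardE -AB [X in _ < X]cardE.
  by rewrite index_cat mem_enum xA index_mem mem_enum.
apply/negbTE; rewrite -in_setC -mem_enum mem_nth //.
have := hi x; rewrite size_cat -!cardE -AB.
have : #|A| <= index x (l A) by rewrite index_cat mem_enum xA -cardE leq_addr.
by lia.
Qed.

Lemma card_ord_ge n m : m <= n -> #|[set i : 'I_n | n - m <= i]| = m.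
Proof.
move=> mn; have := cardsC [set i : 'I_n | i < n - m].
have -> : #|[set i : 'I_n | i < n - m]| = n - m.
  rewrite -sum1_card -[RHS]card_ord -sum1_card.
  rewrite (big_ord_widen n (fun _ => 1)) ?leq_subr //.
  by apply: eq_bigl => i; rewrite inE.
have -> : ~: [set i : 'I_n | i < n - m] = [set i : 'I_n | n - m <= i].
  by apply/setP => i; rewrite !inE -leqNgt.
by rewrite card_ord; lia.
Qed.

(** [L] becomes the cell of [t] vertices of degree [k] in the second part, and [B] the cell of their
    [k] common neighbours. *)
Lemma graph_iso_Mb n k t (b : rel 'I_n) (L B : {set 'I_n}) :
  #|L| = t -> #|B| = k -> t <= n -> k <= n ->
  (forall x y, b x y = (y \notin L) || (x \in B)) ->
  graph_iso b (Mb n (n - k) t).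
Proof.
move=> Lt Bk tn kn bE.
have [pi piE] := exists_perm_mem (etrans (card_ord_ge kn) (esym Bk)).
have [si siE] := exists_perm_mem (etrans (card_ord_ge tn) (esym Lt)).
pose h (i : 'I_(n + n)) := match split i with
  inl x => lshift n (pi x) | inr y => rshift n (si y) end.
have hl x : h (lshift n x) = lshift n (pi x) by rewrite /h split_lshift.
have hr y : h (rshift n y) = rshift n (si y) by rewrite /h split_rshift.
have h_inj : injective h.
  move=> i j; case: (shiftP i) => -[x ->]; case: (shiftP j) => -[y ->];
  rewrite ?hl ?hr => /eqP; rewrite eq_shift // (inj_eq perm_inj) => /eqP -> //.
exists (perm h_inj) => i j; rewrite !permE.
have E x y : b (pi x) (si y) = Mb n (n - k) t x y.
  by rewrite bE piE siE !inE /Mb -ltnNge.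
case: (shiftP i) => -[x ->]; case: (shiftP j) => -[y ->];
by rewrite ?hl ?hr ?adj_ll ?adj_rr ?adj_lr ?adj_rl ?E.
Qed.

(** An isomorphism may exchange the parts, which settles the case of an exceptional set in the first
    part. *)
Lemma graph_iso_transpose n (b b' : rel 'I_n) :
  graph_iso (transpose b) b' -> graph_iso b b'.
Proof.
pose h (i : 'I_(n + n)) := match split i with
  inl x => rshift n x | inr y => lshift n y end.
have hl x : h (lshift n x) = rshift n x by rewrite /h split_lshift.
have hr y : h (rshift n y) = lshift n y by rewrite /h split_rshift.
have hK : involutive h.
  by move=> i; case: (shiftP i) => -[x ->]; rewrite ?hl ?hr ?hl.
move=> [f fE]; exists (f * perm (inv_inj hK))%g => i j; rewrite !permM !permE -fE.
case: (shiftP (f i)) => -[x ->]; case: (shiftP (f j)) => -[y ->];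
by rewrite ?hl ?hr ?adj_ll ?adj_rr ?adj_lr ?adj_rl.
Qed.

(** * Deletion of a balanced vertex set *)

Section BalancedDeletion.
Variables (n p : nat) (b : rel 'I_n) (W : {set 'I_(n + n)}).
Hypothesis W_card : #|W| = 2 * p.
Hypothesis W_balanced : #|[set i in W | inX i]| = #|[set i in W | ~~ inX i]|.
Notation S := (~: W).

Lemma card_side_deleted a : #|side (@inX n) W a| = p.
Proof.
have sT : #|side (@inX n) W true| = #|[set i in W | inX i]|.
  by apply: eq_card => i; rewrite !inE eqb_id.
have sF : #|side (@inX n) W false| = #|[set i in W | ~~ inX i]|.
  by apply: eq_card => i; rewrite !inE eqbF_neg.
have := card_side (@inX n) W; rewrite W_card sT sF W_balanced.
by case: a; rewrite ?sT ?sF ?W_balanced; lia.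
Qed.

Lemma card_side_remaining a : #|side (@inX n) S a| + p = n.
Proof.
rewrite -(card_side_deleted a) -[RHS](card_sideT n a).
rewrite -(cardsID W (side (@inX n) [set: 'I_(n + n)] a)) addnC.
by congr (_ + _); apply: eq_card => i; rewrite !inE andbC.
Qed.

Lemma deg_le_nbr i : deg b i <= #|nbr (adj b) S i| + p.
Proof.
rewrite -(card_side_deleted (~~ inX i)).
apply: leq_trans (leq_card_setU _ _); apply: subset_leq_card.
apply/subsetP => j; rewrite !inE => ij; rewrite ij andbT.
have [_ /(_ _ _ ij)] := adj_bipartite b.
by case: (j \in W) => //=; case: (inX i); case: (inX j).
Qed.

Lemma nonedges_le : nonedges (@inX n) (adj b) S <= \sum_x (n - row_deg b x).
Proof.
apply: leq_trans (_ : \sum_(i | inX i) (n - deg b i) <= _); last first.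
  rewrite big_mkcond big_split_ord /=.
  rewrite [X in _ + X]big1 => [|y _]; last by rewrite inX_r.
  by rewrite addn0; apply: leq_sum => x _; rewrite inX_l deg_l.
rewrite /nonedges big_mkcond [X in _ <= X]big_mkcond /=; apply: leq_sum => i _.
rewrite inE eqb_id; case: (i \in S) => //=; case ci: (inX i) => //.
have := card_nonnbr (adj_bipartite b) (in_setT i); rewrite card_sideT.
have -> : #|nbr (adj b) [set: 'I_(n + n)] i| = deg b i.
  by apply: eq_card => j; rewrite !inE.
have : #|nonnbr (@inX n) (adj b) S i| <= #|nonnbr (@inX n) (adj b) [set: 'I_(n + n)] i|.
  by apply: subset_leq_card; apply/subsetP => j; rewrite !inE => /andP[_ ->].
by move=> le E; apply: leq_trans le _; rewrite -[X in _ <= X - _]E addKn.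
Qed.

Lemma low_row_set (L : {set 'I_(n + n)}) a : L \subset side (@inX n) S a ->
  (forall i, i \in L -> deg b i <= #|L| + p) ->
  exists2 L' : {set 'I_n}, #|L'| = #|L| &
  forall x, x \in L' -> row_deg (if a then b else transpose b) x <= #|L| + p.
Proof.
move=> LS dL; have cL i : i \in L -> inX i = a.
  by move/(subsetP LS); rewrite inE => /andP[_ /eqP].
case: a {LS} cL => cL.
  exists [set x | lshift n x \in L]; last by move=> x; rewrite inE => /dL; rewrite deg_l.
  rewrite [RHS]card_shift [X in _ = _ + X]eq_card0 ?addn0 //.
  by move=> y; rewrite inE; apply/negP => /cL; rewrite inX_r.
exists [set x | rshift n x \in L]; last by move=> x; rewrite inE => /dL; rewrite deg_r.
rewrite [RHS]card_shift [X in _ = X + _]eq_card0 //.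
by move=> y; rewrite inE; apply/negP => /cL; rewrite inX_l.
Qed.

(** One neighbour other than the partner can remain outside [W], and [W] holds at most [p] more. *)
Lemma low_pair_degrees : has_low_pair (@inX n) (adj b) S ->
  exists r s, #|[set y | b r y && (y != s)]| <= p.+1 /\
              #|[set x | b x s && (x != r)]| <= p.+1.
Proof.
have low i j : #|j |: nbr (adj b) S i| <= 2 ->
    #|[set z | adj b i z && (z != j)]| <= p.+1.
  move=> d; rewrite -(card_side_deleted (~~ inX i)) -add1n.
  apply: (@leq_trans (#|nbr (adj b) S i :\ j| + #|side (@inX n) W (~~ inX i)|)).
    apply: leq_trans (leq_card_setU _ _); apply: subset_leq_card.
    apply/subsetP => z; rewrite !inE => /andP[iz zj]; rewrite iz zj andbT.
    have [_ /(_ _ _ iz)] := adj_bipartite b.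
    by case: (z \in W) => //=; case: (inX i); case: (inX z).
  rewrite leq_add2r; move: d; rewrite (cardsD1 j) setU11 add1n ltnS.
  apply: leq_trans; apply: subset_leq_card; apply/subsetP => z.
  by rewrite !inE => /andP[-> ->]; rewrite orbT.
move=> [i [j [iS jS /low di /low dj]]].
have {iS}ci : inX i by move: iS; rewrite inE => /andP[_ /eqP].
have {jS}cj : inX j = false by move: jS; rewrite inE => /andP[_ /eqP].
have [r Er] : exists r, i = lshift n r.
  by case: (shiftP i) => // -[y E]; rewrite E inX_r in ci.
have [s Es] : exists s, j = rshift n s.
  by case: (shiftP j) => // -[x E]; rewrite E inX_l in cj.
exists r, s; split.
  apply: leq_trans di; rewrite card_shift; apply: leq_trans (leq_addl _ _).
  apply: subset_leq_card; apply/subsetP => y.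
  by rewrite !inE Er Es adj_lr eq_shift.
apply: leq_trans dj; rewrite card_shift; apply: leq_trans (leq_addr _ _).
apply: subset_leq_card; apply/subsetP => x.
by rewrite !inE Er Es adj_rl eq_shift.
Qed.

Lemma ham_path_or_low_degrees k u v :
  (forall i, k <= deg b i) -> (k + 2) * (k - p + 1) <= n -> p + 1 <= k ->
  \sum_x (n - row_deg b x) < n * (k - p) ->
  u \in S -> v \in S -> inX u -> ~~ inX v ->
  [\/ ham_path (adj b) S u v,
      exists a (L : {set 'I_n}), #|L| = k - p /\
        forall x, x \in L -> row_deg (if a then b else transpose b) x <= k |
      k - p = 2 /\ exists r s, #|[set y | b r y && (y != s)]| <= k.-1 /\
                               #|[set x | b x s && (x != r)]| <= k.-1].
Proof.
move=> dk kn pk ne uS vS cu cv.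
have sX := card_side_remaining true; have sY := card_side_remaining false.
have [k' kE] : exists t, k = t.+1 + p by exists (k - p).-1; lia.
have kp : k - p = k'.+1 by lia.
rewrite kp in kn ne *.
have [|||||||ham|[a [L [LS Lt dL]]]|[t2 lp]] :=
    @ham_path_or_low _ (@inX n) (adj b) (n - p) k'.+1 (n * k'.+1) S u v
      (adj_bipartite b) _ _ uS cu vS cv.
- by lia.
- by lia.
- by move=> i _; have := deg_le_nbr i; have := dk i; lia.
- exact: leq_ltn_trans nonedges_le ne.
(* With [t = k - p], this is [n t + (t+1)(t+2) <= (t+1)(n-p)], that is, [(t+1)(k+2) <= n]. *)
- by move: kn; rewrite kE; clear; nia.
- by move: kn; rewrite kE; clear; nia.
- by move: kn; rewrite kE; clear; nia.
- exact: Or31.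
- apply: Or32; exists a; have [|L' cL' dL'] := @low_row_set L a LS.
    move=> i iL; rewrite Lt; apply: leq_trans (deg_le_nbr i) _.
    by rewrite leq_add2r dL.
  by exists L'; rewrite cL' Lt; split=> // x /dL'; rewrite Lt kE.
- apply: Or33; split=> //; have [r [s [dr ds]]] := low_pair_degrees lp.
  by exists r, s; split; [apply: leq_trans dr _ | apply: leq_trans ds _]; lia.
Qed.

End BalancedDeletion.

From mathcomp Require Import classical_sets reals polyrcf.

(** * Spectrum of the signless Laplacian *)

Section Spectrum.
Local Open Scope ring_scope.
Variable R : realType.

Lemma Qmat_mul_l n (b : rel 'I_n) (v : 'rV[R]_(n + n)) x :
  (v *m Qmat R b) 0 (lshift n x) = (row_deg b x)%:R * v 0 (lshift n x) +
    \sum_y (b x y)%:R * v 0 (rshift n y).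
Proof.
rewrite mxE big_split_ord /=; congr (_ + _).
  rewrite (bigD1 x) //= !mxE eqxx adj_ll deg_l mulr1 addr0 mulrC big1 ?addr0 //.
  by move=> i ix; rewrite !mxE adj_ll eq_shift (negPf ix) mulr0 addr0 mulr0.
by apply: eq_bigr => y _; rewrite !mxE adj_rl eq_shift mulr0 add0r mulrC.
Qed.

Lemma Qmat_mul_r n (b : rel 'I_n) (v : 'rV[R]_(n + n)) y :
  (v *m Qmat R b) 0 (rshift n y) = (row_deg (transpose b) y)%:R * v 0 (rshift n y) +
    \sum_x (b x y)%:R * v 0 (lshift n x).
Proof.
rewrite mxE big_split_ord /= addrC; congr (_ + _).
  rewrite (bigD1 y) //= !mxE eqxx adj_rr deg_r mulr1 addr0 mulrC big1 ?addr0 //.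
  by move=> i ix; rewrite !mxE adj_rr eq_shift (negPf ix) mulr0 addr0 mulr0.
by apply: eq_bigr => x _; rewrite !mxE adj_lr eq_shift mulr0 add0r mulrC.
Qed.

Lemma eigenvalue_subeigen n (b : rel 'I_n) (a : R) : eigenvalue (Qmat R b) a ->
  exists f g, subeigen a b f g.
Proof.
move=> /eigenvalueP[v va v0].
exists (fun x => `|v 0 (lshift n x)|), (fun y => `|v 0 (rshift n y)|).
have abs (d : nat) (w : R) (h : rel 'I_n) (u : 'I_n -> R) x :
    a * w = d%:R * w + \sum_y (h x y)%:R * u y ->
    a * `|w| <= d%:R * `|w| + \sum_y (h x y)%:R * `|u y|.
  move=> E; apply: le_trans (_ : `|a * w| <= _).
    by rewrite normrM ler_wpM2r // ler_norm.
  rewrite E; apply: le_trans (ler_normD _ _) _; rewrite normrM normr_nat lerD2l.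
  apply: le_trans (ler_norm_sum _ _ _) _; apply: ler_sum => y _.
  by rewrite normrM normr_nat.
split=> // [x|y|].
- by apply: abs; rewrite -Qmat_mul_l va mxE.
- apply: (@abs _ _ (transpose b) (fun x => v 0 (lshift n x))).
  by rewrite -Qmat_mul_r va mxE.
- have /rV0Pn[i vi] := v0.
  by case: (shiftP i) => -[x E]; [left | right]; exists x; rewrite normr_eq0 -E.
Qed.

(** The real eigenvalues are the real roots of a monic polynomial; their finiteness makes the
    supremum in [qrad] an upper bound. *)
Lemma eigenvalue_list n (A : 'M[R]_n) :
  exists rs : seq R, forall a, eigenvalue A a = (a \in rs).
Proof.
exists (rootsR (char_poly A)) => a.
rewrite -(roots_on_rootsR (monic_neq0 (char_poly_monic A))) eigenvalue_root_char.
by rewrite in_itv.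
Qed.

Lemma eigenvalue_le_qrad n (b : rel 'I_n) (a : R) :
  eigenvalue (Qmat R b) a -> a <= qrad R b.
Proof.
move=> ea; apply: ub_le_sup => //=.
have [rs rsE] := eigenvalue_list (Qmat R b).
exists (\big[Order.max/0]_(r <- rs) r) => r /=; rewrite rsE => rrs.
exact: le_bigmax_seq.
Qed.

Lemma qrad_ge_eigenvalue n (b : rel 'I_n) (l : R) : 0 < l -> l <= qrad R b ->
  exists2 a, eigenvalue (Qmat R b) a & l <= a.
Proof.
move=> l0 lq; have [rs rsE] := eigenvalue_list (Qmat R b).
have [/hasP[a ars la]|none] := boolP (has (fun a => l <= a) rs).
  by exists a; rewrite ?rsE.
exfalso; move: lq; apply/negP; rewrite -ltNge.
have lt a : a \in rs -> a < l.
  by move=> ars; rewrite ltNge; apply: contra none => la; apply/hasP; exists a.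
(* The supremum of the empty set is [0] by convention, which [0 < l] rules out. The same positivity
   allows [0] as the initial value of the maximum below. *)
case E: rs => [|a0 rs'].
  have -> : qrad R b = 0; last by [].
  rewrite /qrad (_ : [set a | _]%classic = classical_sets.set0) ?sup0 //.
  by apply/seteqP; split=> a //=; rewrite rsE E.
apply: le_lt_trans (_ : \big[Order.max/0]_(r <- rs) r < l).
  apply: ge_sup; first by exists a0; rewrite /= rsE E mem_head.
  by move=> r /=; rewrite rsE => rrs; apply: le_bigmax_seq.
rewrite big_seq; apply: (big_ind (fun x => x < l)) => // x y xl yl.
by rewrite gt_max xl.
Qed.

Lemma sum_ord_threshold n m (u w : R) : (m <= n)%N ->
  \sum_(i < n) (if (i < m)%N then u else w) = m%:R * u + (n%:R - m%:R) * w.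
Proof.
move=> mn; rewrite -(big_mkord xpredT (fun i => if (i < m)%N then u else w)).
rewrite (big_cat_nat (leq0n m) mn) /=; congr (_ + _).
  rewrite big_nat (eq_bigr (fun=> u)) => [|i /andP[_ ->] //].
  by rewrite -big_nat sumr_const_nat subn0 mulr_natl.
rewrite big_nat (eq_bigr (fun=> w)) => [|i /andP[mi _]]; last by rewrite ltnNge mi.
by rewrite -big_nat sumr_const_nat -natrB // mulr_natl.
Qed.

Lemma row_deg_Mb n k t x : (t <= n)%N ->
  (row_deg (Mb n (n - k) t) x)%:R = (if (x < n - k)%N then n%:R - t%:R else n%:R) :> R.
Proof.
move=> tn; rewrite row_degE /Mb; case: ltnP => h.
  rewrite (eq_bigr (fun y : 'I_n => if (y < n - t)%N then 1 else 0)) => [|y _];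
    last by rewrite orbF; case: ifP.
  by rewrite sum_ord_threshold ?leq_subr // natrB //; ring.
under eq_bigr do rewrite orbT.
by rewrite sumr_const card_ord.
Qed.

Lemma col_deg_Mb n k t y : (k <= n)%N ->
  (row_deg (transpose (Mb n (n - k) t)) y)%:R =
    (if (y < n - t)%N then n%:R else k%:R) :> R.
Proof.
move=> kn; rewrite row_degE /transpose /Mb; case: ltnP => h.
  by rewrite sumr_const card_ord.
rewrite (eq_bigr (fun x : 'I_n => if (x < n - k)%N then 0 else 1)) => [|x _];
  last by rewrite orFb leqNgt; case: ifP.
by rewrite sum_ord_threshold ?leq_subr // natrB //; ring.
Qed.

(** The eigenvector takes the value [N - T] on [X1], [c] on [X2] and [Y1], and [d] on [Y2]. The
    equation at [X1] determines [c], the one at [Y2] determines [d], and those at [X2] and [Y1] both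
    reduce to the quadratic for [l]. *)
Lemma eigenvalue_Mb n k t (l : R) : (0 < t)%N -> (t <= k)%N -> (k < n)%N ->
  0 < l - 2 * n%:R + t%:R ->
  (l - 2 * n%:R + t%:R) * (l - k%:R) = t%:R * k%:R ->
  eigenvalue (Qmat R (Mb n (n - k) t)) l.
Proof.
move=> t0 tk kn l0 lE.
have tn : (t <= n)%N by lia.
have kn' := ltnW kn.
have T0 : 0 < t%:R :> R by rewrite ltr0n.
have tK : t%:R <= k%:R :> R by rewrite ler_nat.
have kN : k%:R < n%:R :> R by rewrite ltr_nat.
set T : R := t%:R in l0 lE T0 tK; set K : R := k%:R in lE tK kN.
set N : R := n%:R in l0 lE kN.
have lK : l - K != 0 by rewrite gt_eqF //; lra.
pose c := l - N + T; pose d := K * c / (l - K).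
have dE : d * (l - K) = K * c by rewrite /d divfK.
have dT : T * d = (l - 2 * N + T) * c.
  by apply: (mulIf lK); rewrite -mulrA dE mulrAC lE; ring.
pose v : 'rV[R]_(n + n) := row_mx
  (\row_(x < n) if (x < n - k)%N then N - T else c)
  (\row_(y < n) if (y < n - t)%N then c else d).
have vl x : v 0 (lshift n x) = if (x < n - k)%N then N - T else c.
  by rewrite row_mxEl mxE.
have vr y : v 0 (rshift n y) = if (y < n - t)%N then c else d.
  by rewrite row_mxEr mxE.
have NT : (n - t)%:R = N - T :> R by rewrite natrB.
have NK : (n - k)%:R = N - K :> R by rewrite natrB.
apply/eigenvalueP; exists v; last first.
  apply/rV0Pn; have n0 : (0 < n)%N by lia.
  exists (lshift n (Ordinal n0)); rewrite vl gt_eqF //=.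
  by case: ifP => _; rewrite /c; lra.
apply/rowP => i; rewrite [RHS]mxE.
case: (shiftP i) => -[x ->].
  rewrite Qmat_mul_l row_deg_Mb // vl; under eq_bigr => y _ do rewrite vr /Mb.
  case: ltnP => h.
    rewrite (eq_bigr (fun y : 'I_n => if (y < n - t)%N then c else 0)) => [|y _];
      last by rewrite orbF; case: ifP; rewrite ?mul1r ?mul0r.
    rewrite sum_ord_threshold ?leq_subr // NT -/N -/T /c.
    by ring.
  under eq_bigr => y _ do rewrite orbT mul1r.
  rewrite sum_ord_threshold ?leq_subr // NT -/N.
  have -> : N - (N - T) = T by ring.
  by rewrite dT /c; ring.
rewrite Qmat_mul_r col_deg_Mb // vr; under eq_bigr => y _ do rewrite vl /Mb.
case: ltnP => h.
  under eq_bigr => y _ do rewrite mul1r.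
  rewrite sum_ord_threshold ?leq_subr // NK -/N /c.
  have -> : N - (N - K) = K by ring.
  suff : l * l = (2 * N - T + K) * l - K * (2 * N - 2 * T) by lra.
  by move: lE; lra.
rewrite (eq_bigr (fun x : 'I_n => if (x < n - k)%N then 0 else c)) => [|x' _];
  last by rewrite orFb leqNgt; case: ifP; rewrite ?mul1r ?mul0r.
rewrite sum_ord_threshold ?leq_subr // NK -/N -/K.
have -> : N - (N - K) = K by ring.
by rewrite -dE; ring.
Qed.

Lemma exists_extremal_root (N T K : R) : 0 < T -> 0 < K -> T + K <= 2 * N ->
  exists2 l, 0 < l - 2 * N + T & (l - 2 * N + T) * (l - K) = T * K.
Proof.
(* With [eps = l - 2 * N + T] the equation becomes [eps * (eps + c) = T * K], whose positive root is
   [(r - c) / 2]. *)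
move=> T0 K0 TK; pose c := 2 * N - T - K.
have c0 : 0 <= c by rewrite /c; lra.
pose r := Num.sqrt (c ^+ 2 + 4 * (T * K)).
have TK0 : 0 < T * K by apply: mulr_gt0.
have r2 : r ^+ 2 = c ^+ 2 + 4 * (T * K).
  by rewrite sqr_sqrtr // addr_ge0 ?sqr_ge0 //; lra.
have cr : c < r.
  rewrite -(@ltr_pXn2r _ 2) ?nnegrE ?sqrtr_ge0 //.
  by rewrite r2; lra.
exists (2 * N - T + (r - c) / 2); first by lra.
have -> : 2 * N - T + (r - c) / 2 - 2 * N + T = (r - c) / 2 by ring.
have -> : 2 * N - T + (r - c) / 2 - K = (r + c) / 2 by rewrite /c; field.
have -> : (r - c) / 2 * ((r + c) / 2) = (r ^+ 2 - c ^+ 2) / 4 by field.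
by rewrite r2; field.
Qed.

End Spectrum.

Theorem theorem1p6 (R : realType) (p k n : nat) (b : rel 'I_n) :
  (forall i : 'I_(n + n), (k <= deg b i)%N) ->
  ((k + 2) * (k - p + 1) <= n)%N ->
  (p + 1 <= k)%N ->
  (qrad R (Mb n (n - k)%N (k - p)%N) <= qrad R b)%R ->
  ~ graph_iso b (Mb n (n - k)%N (k - p)%N) ->
  ham_biconnected_2p p b.
Proof.
move=> dk kn pk qle niso W Wc Wb u v uS vS cu cv.
have kn' : (k + 2 <= n)%N by nia.
have t0 : (0 < k - p)%N by lia.
have tk : (k - p <= k)%N by lia.
have k0 : (0 < k)%N by lia.
have ltkn : (k < n)%N by lia.
have lekn := ltnW ltkn.
have letn := leq_trans tk lekn.
have n0 := leq_trans k0 lekn.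
have TKNn : (k - p + k <= 2 * n)%N by lia.
have T0 : (0 < (k - p)%:R :> R)%R by rewrite ltr0n.
have K0 : (0 < k%:R :> R)%R by rewrite ltr0n.
have TKN : ((k - p)%:R + k%:R <= 2 * n%:R :> R)%R.
  by rewrite -natrD -natrM ler_nat.
have [l l0 lE] := exists_extremal_root T0 K0 TKN.
have lM : (l <= qrad R b)%R.
  by apply: le_trans qle; apply: eigenvalue_le_qrad; apply: eigenvalue_Mb.
have KN : (k%:R < n%:R :> R)%R by rewrite ltr_nat.
have TK : ((k - p)%:R <= k%:R :> R)%R by rewrite ler_nat.
have lpos : (0 < l)%R by move: T0 K0 KN TK l0; clear; lra.
have [q /eigenvalue_subeigen [f [g hs]] lq] := qrad_ge_eigenvalue lpos lM.
have q0 : (0 < q - 2 * n%:R + (k - p)%:R)%R by move: l0 lq; clear; lra.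
(* Both factors are positive at [l] and grow with the variable, so the equation for [l] becomes an
   inequality for [q]. *)
have qE : ((k - p)%:R * k%:R <= (q - 2 * n%:R + (k - p)%:R) * (q - k%:R))%R.
  by rewrite -lE; apply: ler_pM; move: T0 K0 KN TK l0 lq; clear; lra.
have ne : (\sum_x (n - row_deg b x) < n * (k - p))%N.
  have dr x : (0 < row_deg b x)%N by rewrite -deg_l; apply: leq_trans (dk _).
  have dc x : (0 < row_deg (transpose b) x)%N.
    by rewrite -deg_r; apply: leq_trans (dk _).
  have := subeigen_edges hs dr dc.
  have : \sum_x (n - row_deg b x) + \sum_x row_deg b x = (n * n)%N.
    rewrite -big_split /= (eq_bigr (fun=> n)) => [|x _].
      by rewrite sum_nat_const card_ord.
    by rewrite subnK ?row_deg_le.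
  have : (n%:R * (2 * n%:R - (k - p)%:R) < n%:R * q :> R)%R.
    by rewrite ltr_pM2l ?ltr0n //; move: q0; clear; lra.
  move=> h1 h2 h3.
  have : (n%:R * (2 * n%:R) < n%:R ^+ 2 + (\sum_x row_deg b x)%:R + n%:R * (k - p)%:R :> R)%R.
    by move: h1 h3; clear; lra.
  rewrite -!natrM -natrX -!natrD ltr_nat.
  move: h2; set s2 := (\sum_(x < n) row_deg b x)%N.
  by set s1 := (\sum_(x < n) (n - _))%N; move: s1 s2 => s1 s2; clear; nia.
have [//|[a [L [cL dL]]]|[t2 [r [s [dr ds]]]]] :=
    ham_path_or_low_degrees Wc Wb dk kn pk ne uS vS cu cv.
  exfalso; apply: niso.
  have Lpos : (0 < #|L|)%N by rewrite cL.
  have Lk : (#|L| <= k)%N by rewrite cL.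
  rewrite -cL in q0 qE.
  case: a dL => dL.
    have [B cB bE] := subeigen_low_set hs Lpos Lk ltkn dL q0 qE.
    apply: graph_iso_transpose; apply: (graph_iso_Mb cL cB) => //.
    by move=> x y; rewrite /transpose bE.
  have [B cB bE] := subeigen_low_set (subeigen_transpose hs) Lpos Lk ltkn dL q0 qE.
  apply: (graph_iso_Mb cL cB) => //.
  by move=> x y; have := bE y x; rewrite /transpose.
(* [subeigen_low_pair] counts the neighbours other than the partner, so it is applied with
   [k.-1]. *)
exfalso; rewrite t2 in q0 qE.
have kE : (k%:R = k.-1%:R + 1 :> R)%R by rewrite natr1 prednK.
rewrite kE in qE.
by apply: (subeigen_low_pair hs _ dr ds q0 qE); rewrite prednK.
Qed.
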